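(* Let $k$ be a commutative ring, let $\ast\in\{a,b\}$, and let $\boldsymbol{\Psi}_\ast,\boldsymbol{\Gamma}_\ast,\mathbf{S}_\ast,\mathbf{Q}_\ast,\mathbf{R}_\ast,\mathbf{D}_\ast,\mathbf{B}_\ast,\mathbf{K}_\ast$ be the endofunctors of $\mathscr{C}\text{-Mod}$ defined in the context. Then: (1) $(\boldsymbol{\Psi}_\ast,\boldsymbol{\Gamma}_\ast,\mathbf{S}_\ast,\mathbf{Q}_\ast,\mathbf{R}_\ast)$ is a quintuple of adjoint functors in $\mathscr{C}\text{-Mod}$, i.e. each functor in the list is left adjoint to the next one. (2) $(\mathbf{D}_\ast,\mathbf{B}_\ast,\mathbf{S}_\ast\mathbf{K}_\ast)$ is a triple of adjoint functors in $\mathscr{C}\text{-Mod}$, i.e. each functor in the list is left adjoint to the next one. (3) $\mathbf{K}_\ast\mathbf{Q}_\ast\cong\mathbf{B}_\ast$, and $\mathbf{D}_\ast\boldsymbol{\Gamma}_\ast\cong\mathbf{S}_\ast\mathbf{B}_\ast\cong\mathrm{Id}_{\mathscr{C}\text{-Mod}}$.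
   Context: **Category and modules.** $\mathscr{C}$ is the category with objects $[n]=\{1,\dots,n\}$, $n\in\mathbb{N}=\{0,1,2,\dots\}$ ($[0]=\emptyset$), and morphisms the strictly increasing maps (a skeleton of the category $\mathscr{OI}$ of finite totally ordered sets and order-preserving injections). $\mathscr{C}_+$ is the full subcategory on the $[n]$, $n\ge1$. A $\mathscr{C}$-module is a functor $V:\mathscr{C}\to k\text{-Mod}$; $V_n=V([n])$; $\mathscr{C}\text{-Mod}$ is the category of $\mathscr{C}$-modules. A $\mathscr{C}_+$-module is regarded as a $\mathscr{C}$-module with value $0$ at $[0]$. For $v\in V_m$ and $\alpha:[m]\to[n]$ write $\alpha(v)\in V_n$ for the image. **Self-embeddings.** For $\alpha:[m]\to[n]$, $\boldsymbol{\iota}_a(\alpha):[m+1]\to[n+1]$ sends $1\mapsto1$ and $i\mapsto\alpha(i-1)+1$ for $i\ge2$; $\boldsymbol{\iota}_b(\alpha):[m+1]\to[n+1]$ sends $i\mapsto\alpha(i)$ for $i\le m$ and $m+1\mapsto n+1$. These define functors $\boldsymbol\iota_\ast$ with $\boldsymbol\iota_\ast([n])=[n+1]$. For $n\ge0$, $\boldsymbol\rho^a_n:[n]\to[n+1]$ is $i\mapsto i+1$ and $\boldsymbol\rho^b_n:[n]\to[n+1]$ is $i\mapsto i$; these form natural transformations $\mathrm{Id}\to\boldsymbol\iota_\ast$. **$\mathbf S_\ast,\mathbf K_\ast,\mathbf D_\ast$.** $\mathbf S_\ast V=V\circ\boldsymbol\iota_\ast$, so $(\mathbf S_\ast V)_n=V_{n+1}$.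 $\mathbf K_\ast V$ and $\mathbf D_\ast V$ are the kernel and the cokernel of the natural map $V\to\mathbf S_\ast V$ given in degree $n$ by $V(\boldsymbol\rho^\ast_n):V_n\to V_{n+1}$. **$\boldsymbol\Gamma_\ast$.** $(\boldsymbol\Gamma_\ast V)_0=0$ and $(\boldsymbol\Gamma_\ast V)_n=V_0\oplus\cdots\oplus V_{n-1}$ for $n\ge1$. A morphism $\alpha:[m]\to[n]$ with $m\ge1$ acts on $\boldsymbol\Gamma_aV$ by sending, for each $s\in[m]$, the summand $V_{m-s}$ to the summand $V_{n-\alpha(s)}$ via the morphism $[m-s]\to[n-\alpha(s)]$, $i\mapsto\alpha(s+i)-\alpha(s)$; it acts on $\boldsymbol\Gamma_bV$ by sending, for each $s\in[m]$, the summand $V_{s-1}$ to the summand $V_{\alpha(s)-1}$ via the morphism $[s-1]\to[\alpha(s)-1]$, $i\mapsto\alpha(i)$. **$\boldsymbol\Psi_\ast$.** Let $\mathfrak A V\subseteq V$ be the submodule spanned by all $\alpha(v)-\beta(v)$ with $v\in V_m$ and $\alpha,\beta:[m]\to[n]$ having the same source and target (so $V/\mathfrak AV=(k\mathscr C/\mathfrak A)\otimes_{k\mathscr C}V$ where $\mathfrak A$ is the augmentation ideal of the category algebra). Let $\varinjlim V$ be the direct limit of $V_0\to V_1\to V_2\to\cdots$ along the maps $V(\boldsymbol\rho^b_n)$. Set $(\boldsymbol\Psi_aV)_n=\varinjlim\big(\mathbf D_b\mathbf S_b^nV/\mathfrak A(\mathbf D_b\mathbf S_b^nV)\big)$ and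 $(\boldsymbol\Psi_bV)_n=\varinjlim\big(\mathbf D_a\mathbf S_a^nV/\mathfrak A(\mathbf D_a\mathbf S_a^nV)\big)$. A morphism $\alpha:[m]\to[n]$ acts through the $\mathscr C$-module map $\mathbf S_b^mV\to\mathbf S_b^nV$ which in degree $r$ is the map $V_{r+m}\to V_{r+n}$ induced by $i\mapsto i$ for $i\le r$, $i\mapsto\alpha(i-r)+r$ for $r<i\le r+m$ (case $\boldsymbol\Psi_a$); respectively through $\mathbf S_a^mV\to\mathbf S_a^nV$ which in degree $r$ is induced by $[m+r]\to[n+r]$, $i\mapsto\alpha(i)$ for $i\le m$, $m+j\mapsto n+j$ for $1\le j\le r$ (case $\boldsymbol\Psi_b$). **Case distinction.** For $\alpha:[n]\to[\ell]$: for $\ast=a$, say $\alpha$ is of type I if $\ell=0$ (so $\alpha=\mathrm{id}_{[0]}$) or $n\ge1$ and $\alpha(1)=1$; otherwise ($\ell\ge1$ and $1\notin\mathrm{im}\,\alpha$) of type II. For $\ast=b$: type I if $\ell=0$ or $n\ge1$ and $\alpha(n)=\ell$; otherwise ($\ell\ge1$, $\ell\notin\mathrm{im}\,\alpha$) type II. For $\alpha$ of type I with $n\ge1$ let $\alpha_\ast:[n-1]\to[\ell-1]$ be $\alpha_a(i)=\alpha(i+1)-1$, resp. $\alpha_b(i)=\alpha(i)$. For $\alpha$ of type II let $\partial_\ast\alpha:[n]\to[\ell-1]$ be $\partial_a\alpha(i)=\alpha(i)-1$, resp. $\partial_b\alpha(i)=\alpha(i)$; and let $\partial^\ast\alpha:[n+1]\to[\ell]$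 be given by $\partial^a\alpha(1)=1$, $\partial^a\alpha(i)=\alpha(i-1)$ for $i>1$, resp. $\partial^b\alpha(i)=\alpha(i)$ for $i\le n$, $\partial^b\alpha(n+1)=\ell$. **$\mathbf B_\ast$ (negative shift).** $(\mathbf B_\ast V)_0=0$, $(\mathbf B_\ast V)_n=V_{n-1}$ for $n\ge1$; for $n\ge1$, $\alpha:[n]\to[\ell]$ acts by $V(\alpha_\ast):V_{n-1}\to V_{\ell-1}$ if $\alpha$ is of type I and by $0$ if $\alpha$ is of type II. **$\mathbf Q_\ast$.** $(\mathbf Q_\ast V)_n=V_n\oplus V_{n-1}$ with $V_{-1}=0$; $\alpha:[n]\to[\ell]$ acts by $(v,w)\mapsto(\alpha(v),\alpha_\ast(w))$ if of type I (where $w=0$ if $n=0$) and by $(v,w)\mapsto(\alpha(v),\partial_\ast\alpha(v))$ if of type II. **$\mathbf R_\ast$.** $(\mathbf R_\ast V)_n=V_n\oplus(\mathbf K_\ast V)_{n+1}$, where $(\mathbf K_\ast V)_{n+1}\subseteq V_{n+1}$; $\alpha:[n]\to[\ell]$ acts by $(v,w)\mapsto(\alpha(v),\boldsymbol\iota_\ast(\alpha)(w))$ if of type I and by $(v,w)\mapsto(\alpha(v)-\partial^\ast\alpha(w),\boldsymbol\iota_\ast(\alpha)(w))$ if of type II. *)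

(* Defs.v *)
From HB Require Import structures.
From mathcomp Require Import all_boot all_order all_algebra.
From mathcomp Require Import ring_quotient.
From mathcomp Require Import boolp.

Set Implicit Arguments.
Unset Strict Implicit.
Unset Printing Implicit Defensive.
Import GRing.Theory.
Local Open Scope ring_scope.
Local Open Scope quotient_scope.

Inductive side := sa | sb.

Definition opp_side (s : side) : side := if s is sa then sb else sa.

Definition increasing m n (f : {ffun 'I_m -> 'I_n}) : bool :=
  [forall i : 'I_m, forall j : 'I_m, (i < j)%N ==> (f i < f j)%N].

(* The object [n] = {1, ..., n} is encoded as 'I_n = {0, ..., n - 1}. *)
Record mor (m n : nat) := Mor {
  mor_fun :> {ffun 'I_m -> 'I_n};
  mor_inc : increasing mor_fun }.

Lemma mor_ext m n (f g : mor m n) : f =1 g -> f = g.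
Proof.
case: f g => f Hf [g Hg] /= /ffunP fg; move: Hf Hg; rewrite fg => Hf Hg.
by rewrite (bool_irrelevance Hf Hg).
Qed.

Lemma mor_lt m n (f : mor m n) (i j : 'I_m) : (i < j)%N -> (f i < f j)%N.
Proof. by move: (mor_inc f) => /forallP /(_ i) /forallP /(_ j) /implyP. Qed.

Lemma mkmor_subproof m n (f : 'I_m -> 'I_n) :
  (forall i j : 'I_m, i < j -> f i < f j)%N -> increasing (finfun f).
Proof.
by move=> H; apply/forallP => i; apply/forallP => j; apply/implyP => ij;
  rewrite !ffunE H.
Qed.

Definition mkmor m n (f : 'I_m -> 'I_n)
    (H : forall i j : 'I_m, (i < j)%N -> (f i < f j)%N) : mor m n :=
  Mor (mkmor_subproof H).

Lemma mkmorE m n (f : 'I_m -> 'I_n) H i : @mkmor m n f H i = f i.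
Proof. by rewrite ffunE. Qed.

Lemma mor_inj m n (f : mor m n) : injective f.
Proof.
move=> i j fij; apply/eqP; case: (ltngtP i j) => //; last by move/ord_inj->.
- by move=> /(mor_lt f); rewrite fij ltnn.
- by move=> /(mor_lt f); rewrite fij ltnn.
Qed.

Lemma mor_leq m n (f : mor m n) : (m <= n)%N.
Proof. by have := leq_card _ (@mor_inj m n f); rewrite !card_ord. Qed.

Definition idm n : mor n n := @mkmor n n id (fun i j h => h).

Definition compm m n p (g : mor n p) (f : mor m n) : mor m p :=
  @mkmor m p (fun i => g (f i)) (fun i j h => mor_lt g (mor_lt f h)).

(* The element 1 of [n + 1] for a, the element n + 1 of [n + 1] for b.
   So i |-> lift (pole s n) i is i |-> i + 1 for a and i |-> i for b, and
   unlift (pole s n) inverts it. *)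
Definition pole (s : side) n : 'I_n.+1 := if s is sa then ord0 else ord_max.

Lemma val_lift_pole s n (i : 'I_n) :
  lift (pole s n) i = (if s is sa then i.+1 else i) :> nat.
Proof. by case: s => //=; rewrite /bump leqNgt ltn_ord. Qed.

Lemma lift_pole_lt s n (i j : 'I_n) :
  (lift (pole s n) i < lift (pole s n) j)%N = (i < j)%N.
Proof. by rewrite !val_lift_pole; case: s. Qed.

Definition rho (s : side) n : mor n n.+1 :=
  @mkmor n n.+1 (lift (pole s n))
    (fun i j h => etrans (lift_pole_lt s i j) h).


Lemma lt_pole s n (x : 'I_n.+1) : x != pole s n ->
  if s is sa then (pole s n < x)%N else (x < pole s n)%N.
Proof.
rewrite -(inj_eq val_inj); case: s => /=; first by rewrite lt0n.
by move=> xN; rewrite ltn_neqAle xN -ltnS ltn_ord.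
Qed.

Lemma lift_pole_neq s n (i : 'I_n) : lift (pole s n) i != pole s n.
Proof. by rewrite eq_sym neq_lift. Qed.

Definition ext_fun (s : side) m n (f : 'I_m -> 'I_n.+1) (i : 'I_m.+1) :
    'I_n.+1 :=
  if unlift (pole s m) i is Some j then f j else pole s n.

Lemma ext_fun_lt s m n (f : 'I_m -> 'I_n.+1) :
  (forall i, f i != pole s n) ->
  (forall i j : 'I_m, (i < j)%N -> (f i < f j)%N) ->
  forall i j : 'I_m.+1, (i < j)%N -> (ext_fun s f i < ext_fun s f j)%N.
Proof.
move=> fN fI i j; rewrite /ext_fun.
case: unliftP => [i' ->|->]; case: unliftP => [j' ->|->];
  rewrite ?ltnn ?lift_pole_lt //.
- exact: fI.
- by move: (lt_pole (fN i')); case: (s).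
- move: (lt_pole (fN j')) (lt_pole (lift_pole_neq s j')); case: (s) => //.
  by move=> _ h1 h2; move: (ltn_trans h1 h2); rewrite ltnn.
Qed.

Lemma unlift_pole_subproof s n (x : 'I_n.+1) (H : x != pole s n) :
  (unbump (pole s n) x < n)%N.
Proof.
move: (lt_pole H); rewrite /unbump; case: (s) => /= h.
  by rewrite h subn1; case: x {H} h => -[].
by have -> : (n < x)%N = false; rewrite ?subn0 // ltnNge ltnW.
Qed.

(* The inverse of lift (pole s n): x |-> x - 1 for a, x |-> x for b. *)
Definition lower s n (x : 'I_n.+1) (H : x != pole s n) : 'I_n :=
  Ordinal (unlift_pole_subproof H).

Lemma lowerK s n (x : 'I_n.+1) (H : x != pole s n) :
  lift (pole s n) (lower H) = x.
Proof. by apply: val_inj; rewrite /= unbumpK // inE. Qed.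

Definition iota_mor (s : side) m n (f : mor m n) : mor m.+1 n.+1 :=
  @mkmor m.+1 n.+1 (ext_fun s (fun i => lift (pole s n) (f i)))
    (ext_fun_lt (fun i => lift_pole_neq s (f i))
       (fun i j h => etrans (lift_pole_lt s (f i) (f j)) (mor_lt f h))).

Definition typeI (s : side) m n : mor m n -> bool :=
  match m, n return mor m n -> bool with
  | _, 0 => fun _ => true
  | 0, _.+1 => fun _ => false
  | m'.+1, n'.+1 => fun f => f (pole s m') == pole s n'
  end.

Lemma typeI0 s m (f : mor m 0) : typeI s f.
Proof. by case: m f. Qed.

Lemma typeP s m n (f : mor m n) : {typeI s f} + {~~ typeI s f}.
Proof. by case: (boolP (typeI s f)); [left | right]. Qed.

Lemma typeII_neq s m n (f : mor m n.+1) :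
  ~~ typeI s f -> forall i, f i != pole s n.
Proof.
case: m f => [|m] f; first by move=> _ [].
move=> /= fN i; case: (unliftP (pole s m) i) => [j ->|-> //].
have ne := lift_pole_neq s j; move: (lt_pole ne) (lt_pole fN).
case: (s) j {ne fN} => j h1 h2; have h3 := mor_lt f h1; rewrite -(inj_eq val_inj).
  by rewrite gtn_eqF //; apply: ltn_trans h3.
by rewrite ltn_eqF //; apply: ltn_trans h2.
Qed.

Lemma mor_lift_neq s m n (f : mor m.+1 n.+1) (i : 'I_m) :
  f (lift (pole s m) i) != pole s n.
Proof.
have := lt_pole (lift_pole_neq s i); case: (s) => h; have := mor_lt f h;
  rewrite -(inj_eq val_inj) => {}h.
  by rewrite gtn_eqF //; apply: leq_ltn_trans h.
by rewrite ltn_eqF //; apply: leq_trans h _; rewrite -ltnS ltn_ord.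
Qed.

Lemma lower_lt s n (x y : 'I_n.+1) (Hx : x != pole s n) (Hy : y != pole s n) :
  (x < y)%N -> (lower Hx < lower Hy)%N.
Proof. by rewrite -{1}(lowerK Hx) -{1}(lowerK Hy) lift_pole_lt. Qed.

(* alpha_*; the formula makes sense whatever the type of alpha. *)
Definition res_mor (s : side) m n (f : mor m.+1 n.+1) : mor m n :=
  @mkmor m n (fun i => lower (mor_lift_neq s f i))
    (fun i j h => lower_lt _ _ (mor_lt f (etrans (lift_pole_lt s i j) h))).

(* \partial_* alpha *)
Definition del_mor (s : side) m n (f : mor m n.+1) (H : ~~ typeI s f) :
    mor m n :=
  @mkmor m n (fun i => lower (typeII_neq H i))
    (fun i j h => lower_lt _ _ (mor_lt f h)).

(* \partial^* alpha *)
Definition add_mor (s : side) m n (f : mor m n.+1) (H : ~~ typeI s f) :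
    mor m.+1 n.+1 :=
  @mkmor m.+1 n.+1 (ext_fun s f) (ext_fun_lt (typeII_neq H) (@mor_lt _ _ f)).

Lemma ext_fun_pole s m n f : @ext_fun s m n f (pole s m) = pole s n.
Proof. by rewrite /ext_fun unlift_none. Qed.

Lemma ext_fun_lift s m n f j : @ext_fun s m n f (lift (pole s m) j) = f j.
Proof. by rewrite /ext_fun liftK. Qed.

Lemma iota_pole s m n (f : mor m n) : iota_mor s f (pole s m) = pole s n.
Proof. by rewrite mkmorE ext_fun_pole. Qed.

Lemma iota_lift s m n (f : mor m n) i :
  iota_mor s f (lift (pole s m) i) = lift (pole s n) (f i).
Proof. by rewrite mkmorE ext_fun_lift. Qed.

Lemma add_pole s m n (f : mor m n.+1) (H : ~~ typeI s f) :
  add_mor H (pole s m) = pole s n.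
Proof. by rewrite mkmorE ext_fun_pole. Qed.

Lemma add_lift s m n (f : mor m n.+1) (H : ~~ typeI s f) i :
  add_mor H (lift (pole s m) i) = f i.
Proof. by rewrite mkmorE ext_fun_lift. Qed.

Lemma del_lift s m n (f : mor m n.+1) (H : ~~ typeI s f) i :
  lift (pole s n) (del_mor H i) = f i.
Proof. by rewrite mkmorE lowerK. Qed.

Lemma res_lift s m n (f : mor m.+1 n.+1) i :
  lift (pole s n) (res_mor s f i) = f (lift (pole s m) i).
Proof. by rewrite mkmorE lowerK. Qed.

Lemma mor_extS s m n (f g : mor m.+1 n) :
  f (pole s m) = g (pole s m) ->
  (forall i, f (lift (pole s m) i) = g (lift (pole s m) i)) -> f = g.
Proof.
by move=> fg0 fgl; apply: mor_ext => i; case: (unliftP (pole s m) i) => [j|] ->.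
Qed.

Lemma rho_lift s n i : rho s n i = lift (pole s n) i.
Proof. exact: mkmorE. Qed.

Lemma idmE n i : idm n i = i. Proof. exact: mkmorE. Qed.

Lemma compmE m n p (g : mor n p) (f : mor m n) i : compm g f i = g (f i).
Proof. exact: mkmorE. Qed.

Lemma compmA m n p q (h : mor p q) (g : mor n p) (f : mor m n) :
  compm h (compm g f) = compm (compm h g) f.
Proof. by apply: mor_ext => i; rewrite !compmE. Qed.

Lemma comp1m m n (f : mor m n) : compm (idm n) f = f.
Proof. by apply: mor_ext => i; rewrite !compmE idmE. Qed.

Lemma compm1 m n (f : mor m n) : compm f (idm m) = f.
Proof. by apply: mor_ext => i; rewrite !compmE idmE. Qed.

Lemma iota_id s n : iota_mor s (idm n) = idm n.+1.
Proof.
by apply: (@mor_extS s) => [|i]; rewrite ?iota_pole ?iota_lift !idmE.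
Qed.

Lemma iota_comp s m n p (g : mor n p) (f : mor m n) :
  iota_mor s (compm g f) = compm (iota_mor s g) (iota_mor s f).
Proof.
by apply: (@mor_extS s) => [|i];
  rewrite compmE ?iota_pole ?iota_lift // compmE.
Qed.

Lemma rho_nat s m n (f : mor m n) :
  compm (iota_mor s f) (rho s m) = compm (rho s n) f.
Proof.
by apply: mor_ext => i; rewrite !compmE !rho_lift iota_lift.
Qed.

Lemma typeI_comp s m n p (g : mor n p) (f : mor m n) :
  typeI s (compm g f) = typeI s f && typeI s g.
Proof.
case: p g => [|p] g.
  by case: n g f => [|n] g f; [case: m f | have := mor_leq g].
case: n g f => [|n] g f; first by case: m f => [|m] f //; have := mor_leq f.
case: m f => [|m] f //=.
rewrite compmE; case: (unliftP (pole s n) (f (pole s m))) => [j E|->].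
  by rewrite E (negPf (mor_lift_neq s g j)) (negPf (lift_pole_neq s j)).
by rewrite eqxx.
Qed.

Lemma typeI_id s n : typeI s (idm n).
Proof. by case: n => //= n; rewrite idmE. Qed.

Lemma res_id s n : res_mor s (idm n.+1) = idm n.
Proof.
by apply: mor_ext => i; apply: (@lift_inj _ (pole s n)); rewrite res_lift !idmE.
Qed.

Lemma res_comp s m n p (g : mor n.+1 p.+1) (f : mor m.+1 n.+1) :
  res_mor s (compm g f) = compm (res_mor s g) (res_mor s f).
Proof.
by apply: mor_ext => i; apply: (@lift_inj _ (pole s p));
  rewrite compmE !res_lift compmE.
Qed.

Lemma del_comp_l s m n p (g : mor n p.+1) (f : mor m n)
    (H : ~~ typeI s g) (H' : ~~ typeI s (compm g f)) :
  del_mor H' = compm (del_mor H) f.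
Proof.
by apply: mor_ext => i; apply: (@lift_inj _ (pole s p));
  rewrite compmE !del_lift compmE.
Qed.

Lemma del_comp_r s m n p (g : mor n.+1 p.+1) (f : mor m n.+1)
    (H : ~~ typeI s f) (H' : ~~ typeI s (compm g f)) :
  del_mor H' = compm (res_mor s g) (del_mor H).
Proof.
by apply: mor_ext => i; apply: (@lift_inj _ (pole s p));
  rewrite compmE res_lift !del_lift compmE.
Qed.

Lemma rho_del s m n (f : mor m n.+1) (H : ~~ typeI s f) :
  compm (rho s n) (del_mor H) = f.
Proof. by apply: mor_ext => i; rewrite compmE rho_lift del_lift. Qed.

Lemma add_comp_l s m n p (g : mor n p.+1) (f : mor m n)
    (H : ~~ typeI s g) (H' : ~~ typeI s (compm g f)) :
  add_mor H' = compm (add_mor H) (iota_mor s f).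
Proof.
by apply: (@mor_extS s) => [|i];
  rewrite compmE ?add_pole ?iota_pole ?add_pole // iota_lift !add_lift compmE.
Qed.

Lemma add_comp_r s m n p (g : mor n.+1 p.+1) (f : mor m n.+1)
    (Hg : typeI s g) (H : ~~ typeI s f) (H' : ~~ typeI s (compm g f)) :
  add_mor H' = compm g (add_mor H).
Proof.
move: Hg => /= /eqP Hg.
by apply: (@mor_extS s) => [|i]; rewrite compmE ?add_pole ?add_lift // compmE.
Qed.

Definition mklin (k : pzRingType) (U W : lmodType k) (f : U -> W)
    (H : linear f) : {linear U -> W} :=
  HB.pack f (GRing.isLinear.Build k U W *:%R f H).

Lemma lin_ext (k : pzRingType) (U W : lmodType k) (f g : {linear U -> W}) :
  f =1 g -> f = g.
Proof.
move=> /funext; case: f g => [f [[Hf] [Hf']]] [g [[Hg] [Hg']]] /= fg.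
move: Hf Hf' Hg Hg'; rewrite fg => Hf Hf' Hg Hg'.
by rewrite (Prop_irrelevance Hf Hg) (Prop_irrelevance Hf' Hg').
Qed.

(* Functors from the category of the [n] and strictly increasing maps to
   k-modules. *)
Record cmod (k : pzRingType) := CMod {
  cobj :> nat -> lmodType k;
  cact : forall m n, mor m n -> {linear cobj m -> cobj n};
  cact_id : forall n (v : cobj n), cact (idm n) v = v;
  cact_comp : forall m n p (g : mor n p) (f : mor m n) (v : cobj m),
    cact (compm g f) v = cact g (cact f v) }.

Record chom (k : pzRingType) (V W : cmod k) := CHom {
  cfun :> forall n, {linear V n -> W n};
  cnat : forall m n (f : mor m n) (v : V m),
    cfun n (cact V f v) = cact W f (cfun m v) }.

Section CModules.
Variable k : pzRingType.
Implicit Types U V W : cmod k.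

Lemma chom_ext V W (f g : chom V W) : (forall n v, f n v = g n v) -> f = g.
Proof.
move=> fg; have E : cfun f = cfun g.
  by apply: functional_extensionality_dep => n; apply: lin_ext => v.
case: f g E {fg} => [f Hf] [g Hg] /= E; move: Hf Hg; rewrite E => Hf Hg.
by rewrite (Prop_irrelevance Hf Hg).
Qed.

Definition chom_id V : chom V V :=
  @CHom k V V (fun n => idfun : {linear V n -> V n}) (fun m n f v => erefl).

Lemma chom_comp_subproof U V W (g : chom V W) (f : chom U V) m n
    (a : mor m n) (u : U m) :
  (g n \o f n) (cact U a u) = cact W a ((g m \o f m) u).
Proof. by rewrite /= !cnat. Qed.

Definition chom_comp U V W (g : chom V W) (f : chom U V) : chom U W :=
  @CHom k U W (fun n => (g n \o f n : {linear U n -> W n}))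
    (chom_comp_subproof g f).
End CModules.

(* Endofunctors of the category of C-modules. *)
Record cfunctor (k : pzRingType) := CFunctor {
  fobj :> cmod k -> cmod k;
  fmap : forall V W, chom V W -> chom (fobj V) (fobj W);
  fmap_id : forall V, fmap (chom_id V) = chom_id (fobj V);
  fmap_comp : forall U V W (g : chom V W) (f : chom U V),
    fmap (chom_comp g f) = chom_comp (fmap g) (fmap f) }.

Section Functors.
Variable k : pzRingType.
Implicit Types F G : cfunctor k.

Definition idF : cfunctor k :=
  @CFunctor k id (fun V W f => f) (fun V => erefl) (fun U V W g f => erefl).

Lemma compF_id F G V :
  fmap G (fmap F (chom_id V)) = chom_id (G (F V)).
Proof. by rewrite !fmap_id. Qed.

Lemma compF_comp F G U V W (g : chom V W) (f : chom U V) :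
  fmap G (fmap F (chom_comp g f)) =
  chom_comp (fmap G (fmap F g)) (fmap G (fmap F f)).
Proof. by rewrite !fmap_comp. Qed.

Definition compF G F : cfunctor k :=
  @CFunctor k (fun V => G (F V)) (fun V W f => fmap G (fmap F f))
    (@compF_id F G) (@compF_comp F G).

Definition left_adjoint F G : Prop :=
  exists phi : forall V W, chom (F V) W -> chom V (G W),
    (forall V W, bijective (@phi V W)) /\
    (forall V V' W W' (f : chom V' V) (g : chom W W') (h : chom (F V) W),
       phi V' W' (chom_comp g (chom_comp h (fmap F f))) =
       chom_comp (fmap G g) (chom_comp (phi V W h) f)).

Definition nat_iso F G : Prop :=
  exists (eta : forall V, chom (F V) (G V)) (theta : forall V, chom (G V) (F V)),
    (forall V W (f : chom V W),
       chom_comp (eta W) (fmap F f) = chom_comp (fmap G f) (eta V)) /\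
    (forall V, chom_comp (theta V) (eta V) = chom_id (F V)) /\
    (forall V, chom_comp (eta V) (theta V) = chom_id (G V)).
End Functors.

Section LModConstructions.
Variable k : pzRingType.

Definition kerp (U W : lmodType k) (f : {linear U -> W}) : {pred U} :=
  fun x => f x == 0.

Lemma kerp_closed (U W : lmodType k) (f : {linear U -> W}) :
  submod_closed (kerp f).
Proof.
split; first by rewrite unfold_in /kerp linear0.
by move=> a u v; rewrite !unfold_in /kerp linearP => /eqP-> /eqP->;
  rewrite scaler0 addr0.
Qed.

HB.instance Definition _ (U W : lmodType k) (f : {linear U -> W}) :=
  GRing.isSubmodClosed.Build k U (kerp f) (kerp_closed f).

Record kermod (U W : lmodType k) (f : {linear U -> W}) :=
  KerMod { kerval : U; kervalP : kerval \in kerp f }.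

HB.instance Definition _ (U W : lmodType k) (f : {linear U -> W}) :=
  [isSub for @kerval U W f].
HB.instance Definition _ (U W : lmodType k) (f : {linear U -> W}) :=
  [Choice of kermod f by <:].
HB.instance Definition _ (U W : lmodType k) (f : {linear U -> W}) :=
  [SubChoice_isSubLmodule of kermod f by <:].

Record submod (U : lmodType k) := SubMod {
  subP :> U -> Prop;
  sub0P : subP 0;
  subL : forall a u v, subP u -> subP v -> subP (a *: u + v) }.

Inductive span (U : lmodType k) (G : U -> Prop) : U -> Prop :=
  | span_0 : span G 0
  | span_lin a u v : G u -> span G v -> span G (a *: u + v).

Lemma span_closed (U : lmodType k) (G : U -> Prop) a u v :
  span G u -> span G v -> span G (a *: u + v).
Proof.
move=> Gu Gv; elim: Gu => [|b x y Gx _ IH]; first by rewrite scaler0 add0r.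
by rewrite scalerDr scalerA -addrA; apply: span_lin.
Qed.

Definition spanmod (U : lmodType k) (G : U -> Prop) : submod U :=
  SubMod (span_0 G) (@span_closed U G).

Lemma span_gen (U : lmodType k) (G : U -> Prop) u : G u -> span G u.
Proof.
by move=> Gu; have := span_lin 1 Gu (span_0 G); rewrite scale1r addr0.
Qed.

Lemma im_closed (U W : lmodType k) (f : {linear U -> W}) a u v :
  (exists x, u = f x) -> (exists x, v = f x) ->
  exists x, a *: u + v = f x.
Proof. by move=> [x ->] [y ->]; exists (a *: x + y); rewrite linearP. Qed.

Definition immod (U W : lmodType k) (f : {linear U -> W}) : submod W :=
  @SubMod W (fun y => exists x, y = f x)
    (ex_intro _ 0 (esym (linear0 f))) (@im_closed U W f).

Definition subpred (U : lmodType k) (P : submod U) : {pred U} :=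
  fun x => `[< P x >].

Lemma subpred_closed (U : lmodType k) (P : submod U) :
  submod_closed (subpred P).
Proof.
split; first exact/asboolP/sub0P.
by move=> a u v /asboolP Pu /asboolP Pv; apply/asboolP; apply: subL.
Qed.

HB.instance Definition _ (U : lmodType k) (P : submod U) :=
  GRing.isSubmodClosed.Build k U (subpred P) (subpred_closed P).

Definition quotmod (U : lmodType k) (P : submod U) := Quotient.quot (subpred P).

Section Quot.
Variables (U : lmodType k) (P : submod U).

HB.instance Definition _ := GRing.Zmodule.on (quotmod P).

Definition qpi (x : U) : quotmod P := \pi_(Quotient.quot (subpred P)) x.

Lemma qpiP (x y : U) : qpi x = qpi y <-> P (x - y).
Proof.
split.
  by move=> /eqP; rewrite -Quotient.idealrBE => /asboolP.
by move=> H; apply/eqP; rewrite -Quotient.idealrBE; apply/asboolP.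
Qed.

Lemma qpi_surj (u : quotmod P) : exists x, u = qpi x.
Proof. by exists (repr u); rewrite /qpi reprK. Qed.

Lemma qpiD x y : qpi (x + y) = qpi x + qpi y.
Proof. by rewrite /qpi raddfD. Qed.

Definition qscale (a : k) (u : quotmod P) : quotmod P :=
  qpi (a *: repr (u : Quotient.quot (subpred P))).

Lemma qscaleE a x : qscale a (qpi x) = qpi (a *: x).
Proof.
apply/qpiP; rewrite -scalerBr -[_ *: _]addr0; apply: subL; last exact: sub0P.
by apply/qpiP; rewrite /qpi reprK.
Qed.

Lemma qscaleA a b u : qscale a (qscale b u) = qscale (a * b) u.
Proof. by have [x ->] := qpi_surj u; rewrite !qscaleE scalerA. Qed.

Lemma qscale1 : left_id 1 qscale.
Proof. by move=> u; have [x ->] := qpi_surj u; rewrite qscaleE scale1r. Qed.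

Lemma qscaleDr : right_distributive qscale +%R.
Proof.
move=> a u v; have [x ->] := qpi_surj u; have [y ->] := qpi_surj v.
by rewrite -qpiD !qscaleE scalerDr qpiD.
Qed.

Lemma qscaleDl u : {morph qscale^~ u : a b / a + b}.
Proof.
by move=> a b; have [x ->] := qpi_surj u; rewrite !qscaleE scalerDl qpiD.
Qed.

HB.instance Definition _ := GRing.Zmodule_isLmodule.Build k (quotmod P)
  qscaleA qscale1 qscaleDr qscaleDl.

Lemma qpi_linear : linear qpi.
Proof. by move=> a x y; rewrite qpiD -qscaleE. Qed.

HB.instance Definition _ := GRing.isLinear.Build k U (quotmod P) _ qpi
  qpi_linear.
End Quot.

Section QuotMap.
Variables (U W : lmodType k) (P : submod U) (Q : submod W).
Variables (f : {linear U -> W}) (H : forall x, P x -> Q (f x)).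

Definition qmap_fun (u : quotmod P) : quotmod Q :=
  locked (fun v : quotmod P =>
    qpi Q (f (repr (v : Quotient.quot (subpred P))))) u.

Lemma qmap_funE x : qmap_fun (qpi P x) = qpi Q (f x).
Proof.
rewrite /qmap_fun -lock; apply/qpiP; rewrite -linearB; apply: H; apply/qpiP; rewrite /qpi reprK //.
Qed.

Lemma qmap_linear : linear qmap_fun.
Proof.
move=> a u v; have [x ->] := qpi_surj u; have [y ->] := qpi_surj v.
by rewrite -linearP !qmap_funE !linearP.
Qed.

Definition qmap : {linear quotmod P -> quotmod Q} := mklin qmap_linear.

Lemma qmapE x : qmap (qpi P x) = qpi Q (f x). Proof. exact: qmap_funE. Qed.
End QuotMap.

Definition dsum n (T : 'I_n -> lmodType k) := {dffun forall i : 'I_n, T i}.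

Section DSum.
Variables (n : nat) (T : 'I_n -> lmodType k).
Implicit Types x y : dsum T.

HB.instance Definition _ := Choice.on (dsum T).

Definition ds_add x y : dsum T := [ffun i => x i + y i].
Definition ds_opp x : dsum T := [ffun i => - x i].
Definition ds_zero : dsum T := [ffun i => 0].
Definition ds_scale a x : dsum T := [ffun i => a *: x i].

Lemma ds_addA : associative ds_add.
Proof. by move=> x y z; apply/ffunP => i; rewrite !ffunE addrA. Qed.
Lemma ds_addC : commutative ds_add.
Proof. by move=> x y; apply/ffunP => i; rewrite !ffunE addrC. Qed.
Lemma ds_add0 : left_id ds_zero ds_add.
Proof. by move=> x; apply/ffunP => i; rewrite !ffunE add0r. Qed.
Lemma ds_addN : left_inverse ds_zero ds_opp ds_add.
Proof. by move=> x; apply/ffunP => i; rewrite !ffunE addNr. Qed.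

HB.instance Definition _ := GRing.isZmodule.Build (dsum T)
  ds_addA ds_addC ds_add0 ds_addN.

Lemma ds_scaleA a b x : ds_scale a (ds_scale b x) = ds_scale (a * b) x.
Proof. by apply/ffunP => i; rewrite !ffunE scalerA. Qed.
Lemma ds_scale1 : left_id 1 ds_scale.
Proof. by move=> x; apply/ffunP => i; rewrite !ffunE scale1r. Qed.
Lemma ds_scaleDr : right_distributive ds_scale +%R.
Proof. by move=> a x y; apply/ffunP => i; rewrite !ffunE scalerDr. Qed.
Lemma ds_scaleDl x : {morph ds_scale^~ x : a b / a + b}.
Proof. by move=> a b; apply/ffunP => i; rewrite !ffunE scalerDl. Qed.

HB.instance Definition _ := GRing.Zmodule_isLmodule.Build k (dsum T)
  ds_scaleA ds_scale1 ds_scaleDr ds_scaleDl.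

Lemma dsD x y i : (x + y) i = x i + y i. Proof. exact: ffunE. Qed.
Lemma dsZ a x i : (a *: x) i = a *: x i. Proof. exact: ffunE. Qed.
Lemma ds0 i : (0 : dsum T) i = 0. Proof. exact: ffunE. Qed.

Definition dinj i (v : T i) : dsum T := 
  [ffun j => @dfwith _ T (fun _ => 0) i v j].

Lemma dinj_in i (v : T i) : dinj v i = v.
Proof. by rewrite ffunE dfwith_in. Qed.

Lemma dinj_out i j (v : T i) : i != j -> dinj v j = 0.
Proof. by move=> ij; rewrite ffunE dfwith_out. Qed.

Lemma dinj_linear i : linear (@dinj i).
Proof.
move=> a u v; apply/ffunP => j; rewrite dsD dsZ.
have [<-|ij] := eqVneq i j; first by rewrite !dinj_in.
by rewrite !dinj_out // scaler0 addr0.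
Qed.

HB.instance Definition _ i := GRing.isLinear.Build k (T i) (dsum T) _
  (@dinj i) (@dinj_linear i).

Lemma ds_sum (I : Type) (r : seq I) (F : I -> dsum T) i :
  (\sum_(j <- r) F j) i = \sum_(j <- r) F j i.
Proof. by elim/big_ind2: _ => [|x a y b <- <-|]; rewrite ?ds0 ?dsD. Qed.

Lemma ds_decomp x : x = \sum_i dinj (x i).
Proof.
apply/ffunP => i; rewrite ds_sum (bigD1 i) //= dinj_in big1 ?addr0 // => j ji.
by rewrite dinj_out.
Qed.
End DSum.
End LModConstructions.

Section KerVal.
Variables (k : pzRingType) (U W : lmodType k) (f : {linear U -> W}).

Lemma kerval_linear : linear (@kerval k U W f).
Proof. by move=> a x y; exact: (linearP (val : kermod f -> U)). Qed.

HB.instance Definition _ :=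
  GRing.isLinear.Build k (kermod f) U _ (@kerval k U W f) kerval_linear.
End KerVal.

Section KerMap.
Variables (k : pzRingType) (U W U' W' : lmodType k).
Variables (f : {linear U -> W}) (f' : {linear U' -> W'}) (g : {linear U -> U'}).
Hypothesis H : forall x, f x = 0 -> f' (g x) = 0.

Lemma kerval0 (x : kermod f) : f (kerval x) = 0.
Proof. exact/eqP/(kervalP x). Qed.

Lemma kmap_subproof (x : kermod f) : g (kerval x) \in kerp f'.
Proof. by apply/eqP/H/kerval0. Qed.

Definition kmap_fun (x : kermod f) : kermod f' := KerMod (kmap_subproof x).

Lemma kmap_linear : linear kmap_fun.
Proof.
by move=> a x y; apply: val_inj; rewrite /= !linearP.
Qed.

Definition kmap : {linear kermod f -> kermod f'} := mklin kmap_linear.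
End KerMap.

Definition zlin (k : pzRingType) (U W : lmodType k) : {linear U -> W} :=
  \0%R : {linear U -> W}.

Section Shift.
Variables (k : pzRingType) (s : side).
Implicit Types U V W : cmod k.

Fixpoint iota_pow (j : nat) m n (f : mor m n) : mor (j + m) (j + n) :=
  match j with
  | 0 => f
  | j'.+1 => iota_mor s (iota_pow j' f)
  end.

Lemma iota_pow_id j n : iota_pow j (idm n) = idm (j + n).
Proof. by elim: j => //= j ->; rewrite iota_id. Qed.

Lemma iota_pow_comp j m n p (g : mor n p) (f : mor m n) :
  iota_pow j (compm g f) = compm (iota_pow j g) (iota_pow j f).
Proof. by elim: j => //= j ->; rewrite iota_comp. Qed.

(* S_*^j V = V o iota_*^j *)
Section Obj.
Variables (j : nat) (V : cmod k).

Lemma Spow_act_id n (v : V (j + n)) : cact V (iota_pow j (idm n)) v = v.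
Proof. by rewrite iota_pow_id cact_id. Qed.

Lemma Spow_act_comp m n p (g : mor n p) (f : mor m n) (v : V (j + m)) :
  cact V (iota_pow j (compm g f)) v =
  cact V (iota_pow j g) (cact V (iota_pow j f) v).
Proof. by rewrite iota_pow_comp cact_comp. Qed.

Definition Spow_obj : cmod k :=
  @CMod k (fun n => V (j + n)) (fun m n f => cact V (iota_pow j f))
    Spow_act_id Spow_act_comp.
End Obj.

Definition Spow_map j V W (f : chom V W) : chom (Spow_obj j V) (Spow_obj j W) :=
  @CHom k (Spow_obj j V) (Spow_obj j W) (fun n => f (j + n))
    (fun m n a v => cnat f (iota_pow j a) v).

Lemma Spow_id j V : Spow_map j (chom_id V) = chom_id (Spow_obj j V).
Proof. exact: chom_ext. Qed.

Lemma Spow_comp j U V W (g : chom V W) (f : chom U V) :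
  Spow_map j (chom_comp g f) = chom_comp (Spow_map j g) (Spow_map j f).
Proof. exact: chom_ext. Qed.

Definition Spow j : cfunctor k :=
  @CFunctor k (Spow_obj j) (@Spow_map j) (Spow_id j) (@Spow_comp j).
End Shift.

(* iota_pow s 1 f is convertible to iota_mor s f. *)
Definition Sfun (k : pzRingType) (s : side) : cfunctor k := Spow k s 1.

Section KFunctor.
Variables (k : pzRingType) (s : side).
Implicit Types U V W : cmod k.

Section Obj.
Variable V : cmod k.

Lemma K_act_subproof m n (f : mor m n) (v : V m) :
  cact V (rho s m) v = 0 -> cact V (rho s n) (cact V f v) = 0.
Proof. by move=> H; rewrite -cact_comp -rho_nat cact_comp H linear0. Qed.

Definition K_act m n (f : mor m n) :
    {linear kermod (cact V (rho s m)) -> kermod (cact V (rho s n))} :=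
  kmap (@K_act_subproof m n f).

Lemma K_act_id n v : K_act (idm n) v = v.
Proof. by apply: val_inj; rewrite /= cact_id. Qed.

Lemma K_act_comp m n p (g : mor n p) (f : mor m n) v :
  K_act (compm g f) v = K_act g (K_act f v).
Proof. by apply: val_inj; rewrite /= cact_comp. Qed.

Definition K_obj : cmod k :=
  @CMod k (fun n => kermod (cact V (rho s n))) K_act K_act_id K_act_comp.
End Obj.

Lemma K_map_subproof V W (f : chom V W) n (v : V n) :
  cact V (rho s n) v = 0 -> cact W (rho s n) (f n v) = 0.
Proof. by move=> H; rewrite -cnat H linear0. Qed.

Lemma K_map_nat V W (f : chom V W) m n (a : mor m n) v :
  kmap (@K_map_subproof V W f n) (cact (K_obj V) a v) =
  cact (K_obj W) a (kmap (@K_map_subproof V W f m) v).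
Proof. by apply: val_inj; rewrite /= cnat. Qed.

Definition K_map V W (f : chom V W) : chom (K_obj V) (K_obj W) :=
  @CHom k (K_obj V) (K_obj W) (fun n => kmap (@K_map_subproof V W f n))
    (K_map_nat f).

Lemma K_id V : K_map (chom_id V) = chom_id (K_obj V).
Proof. by apply: chom_ext => n v; apply: val_inj. Qed.

Lemma K_comp U V W (g : chom V W) (f : chom U V) :
  K_map (chom_comp g f) = chom_comp (K_map g) (K_map f).
Proof. by apply: chom_ext => n v; apply: val_inj. Qed.

Definition Kfun : cfunctor k := CFunctor K_id K_comp.
End KFunctor.

Section DFunctor.
Variables (k : pzRingType) (s : side).
Implicit Types U V W : cmod k.

Section Obj.
Variable V : cmod k.

Lemma D_act_subproof m n (f : mor m n) (v : V m.+1) :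
  immod (cact V (rho s m)) v ->
  immod (cact V (rho s n)) (cact V (iota_mor s f) v).
Proof.
move=> [x ->]; exists (cact V f x).
by rewrite -!cact_comp rho_nat.
Qed.

Definition D_act m n (f : mor m n) :
    {linear quotmod (immod (cact V (rho s m))) ->
            quotmod (immod (cact V (rho s n)))} :=
  qmap (@D_act_subproof m n f).

Lemma D_act_id n v : D_act (idm n) v = v.
Proof. by have [x ->] := qpi_surj v; rewrite qmapE iota_id cact_id. Qed.

Lemma D_act_comp m n p (g : mor n p) (f : mor m n) v :
  D_act (compm g f) v = D_act g (D_act f v).
Proof.
by have [x ->] := qpi_surj v; rewrite !qmapE iota_comp cact_comp.
Qed.

Definition D_obj : cmod k :=
  @CMod k (fun n => quotmod (immod (cact V (rho s n)))) D_act
    D_act_id D_act_comp.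
End Obj.

Lemma D_map_subproof V W (f : chom V W) n (v : V n.+1) :
  immod (cact V (rho s n)) v -> immod (cact W (rho s n)) (f n.+1 v).
Proof. by move=> [x ->]; exists (f n x); rewrite cnat. Qed.

Lemma D_map_nat V W (f : chom V W) m n (a : mor m n) v :
  qmap (@D_map_subproof V W f n) (cact (D_obj V) a v) =
  cact (D_obj W) a (qmap (@D_map_subproof V W f m) v).
Proof. by have [x ->] := qpi_surj v; rewrite !qmapE cnat. Qed.

Definition D_map V W (f : chom V W) : chom (D_obj V) (D_obj W) :=
  @CHom k (D_obj V) (D_obj W) (fun n => qmap (@D_map_subproof V W f n))
    (D_map_nat f).

Lemma D_id V : D_map (chom_id V) = chom_id (D_obj V).
Proof.
by apply: chom_ext => n v; have [x ->] := qpi_surj v; rewrite /= qmap_funE.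
Qed.

Lemma D_comp U V W (g : chom V W) (f : chom U V) :
  D_map (chom_comp g f) = chom_comp (D_map g) (D_map f).
Proof.
apply: chom_ext => n v; have [x ->] := qpi_surj v; rewrite /= !qmap_funE //;
  [exact: (D_map_subproof g) | exact: (D_map_subproof f)
  | exact: (D_map_subproof (chom_comp g f))].
Qed.

Definition Dfun : cfunctor k := CFunctor D_id D_comp.
End DFunctor.

(* V |-> V / AV for the augmentation ideal A of the category algebra *)
Section Coinvariants.
Variable k : pzRingType.
Implicit Types V W : cmod k.

Definition aug_gen (V : cmod k) n (x : V n) : Prop :=
  exists m (f g : mor m n) (v : V m), x = cact V f v - cact V g v.

Definition aug (V : cmod k) n : submod (V n) := spanmod (@aug_gen V n).

Lemma spanmod_sub (U : lmodType k) (G : U -> Prop) (P : submod U) :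
  (forall x, G x -> P x) -> forall x, spanmod G x -> P x.
Proof.
move=> GP x; elim=> [|a u v Gu _ IH]; first exact: sub0P.
by apply: subL => //; apply: GP.
Qed.

Lemma preim_closed (U W : lmodType k) (f : {linear U -> W}) (P : submod W)
  a u v : P (f u) -> P (f v) -> P (f (a *: u + v)).
Proof. by move=> Pu Pv; rewrite linearP; apply: subL. Qed.

Definition preim_mod (U W : lmodType k) (f : {linear U -> W}) (P : submod W) :
    submod U :=
  @SubMod k U (fun x => P (f x)) (eq_ind_r P (sub0P P) (linear0 f))
    (@preim_closed U W f P).

Lemma span_map (U W : lmodType k) (f : {linear U -> W}) G G' :
  (forall x, G x -> G' (f x)) -> forall x, spanmod G x -> spanmod G' (f x).
Proof.
move=> GG; apply: (@spanmod_sub _ _ (preim_mod f (spanmod G'))) => x Gx /=.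
exact/span_gen/GG.
Qed.

Lemma aug_act (V : cmod k) m n (a : mor m n) (v : V m) :
  aug V m v -> aug V n (cact V a v).
Proof.
apply: span_map => {}v [p [f [g [x ->]]]].
by exists p, (compm a f), (compm a g), x; rewrite linearB !cact_comp.
Qed.

Lemma aug_hom (V W : cmod k) (f : chom V W) n (v : V n) :
  aug V n v -> aug W n (f n v).
Proof.
apply: span_map => {}v [p [a [b [x ->]]]].
by exists p, a, b, (f p x); rewrite linearB !cnat.
Qed.

Definition A_act V m n (f : mor m n) :
    {linear quotmod (aug V m) -> quotmod (aug V n)} := qmap (@aug_act V m n f).

Lemma A_act_id V n v : A_act V (idm n) v = v.
Proof. by have [x ->] := qpi_surj v; rewrite qmapE cact_id. Qed.

Lemma A_act_comp V m n p (g : mor n p) (f : mor m n) v :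
  A_act V (compm g f) v = A_act V g (A_act V f v).
Proof. by have [x ->] := qpi_surj v; rewrite !qmapE cact_comp. Qed.

Definition A_obj V : cmod k :=
  CMod (@A_act_id V) (@A_act_comp V).

Lemma A_map_nat V W (f : chom V W) m n (a : mor m n) v :
  qmap (@aug_hom V W f n) (cact (A_obj V) a v) =
  cact (A_obj W) a (qmap (@aug_hom V W f m) v).
Proof. by have [x ->] := qpi_surj v; rewrite !qmapE cnat. Qed.

Definition A_map V W (f : chom V W) : chom (A_obj V) (A_obj W) :=
  @CHom k (A_obj V) (A_obj W) (fun n => qmap (@aug_hom V W f n)) (A_map_nat f).

Lemma A_id V : A_map (chom_id V) = chom_id (A_obj V).
Proof.
by apply: chom_ext => n v; have [x ->] := qpi_surj v; rewrite /= qmap_funE.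
Qed.

Lemma A_comp (U V W : cmod k) (g : chom V W) (f : chom U V) :
  A_map (chom_comp g f) = chom_comp (A_map g) (A_map f).
Proof.
apply: chom_ext => n v; have [x ->] := qpi_surj v; rewrite /= !qmap_funE //;
  [exact: (aug_hom g) | exact: (aug_hom f)
  | exact: (aug_hom (chom_comp g f))].
Qed.

Definition Coinv : cfunctor k := CFunctor A_id A_comp.
End Coinvariants.

Section Gamma.
Variables (k : pzRingType) (s : side).
Implicit Types U V W : cmod k.

Lemma tail_subproof m (i : 'I_m) (j : 'I_(m - i.+1)) : (i.+1 + j < m)%N.
Proof. by rewrite -ltn_subRL. Qed.

Definition tail m (i : 'I_m) (j : 'I_(m - i.+1)) : 'I_m :=
  Ordinal (tail_subproof j).

Lemma tail_gt m n (f : mor m n) (i : 'I_m) (j : 'I_(m - i.+1)) :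
  (f i < f (tail j))%N.
Proof. by apply: mor_lt; rewrite /= addSn ltnS leq_addr. Qed.

Lemma gmor_a_subproof m n (f : mor m n) (i : 'I_m) (j : 'I_(m - i.+1)) :
  (f (tail j) - (f i).+1 < n - (f i).+1)%N.
Proof. by rewrite ltn_sub2r // (leq_ltn_trans (tail_gt f j)). Qed.

Lemma gmor_a_lt m n (f : mor m n) (i : 'I_m) (j j' : 'I_(m - i.+1)) :
  (j < j')%N -> (f (tail j) - (f i).+1 < f (tail j') - (f i).+1)%N.
Proof.
move=> h; have h' : (f (tail j) < f (tail j'))%N.
  by apply: mor_lt; rewrite /= ltn_add2l.
by rewrite ltn_sub2r // (leq_ltn_trans (tail_gt f j)).
Qed.

Definition gmor_a m n (f : mor m n) (i : 'I_m) : mor (m - i.+1) (n - (f i).+1) :=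
  @mkmor _ _ (fun j => Ordinal (gmor_a_subproof f j)) (@gmor_a_lt m n f i).

Lemma gmor_b_subproof m n (f : mor m n) (i : 'I_m) (j : 'I_i) :
  (f (widen_ord (ltnW (ltn_ord i)) j) < f i)%N.
Proof. by apply: mor_lt; apply: (ltn_ord j). Qed.

Definition gmor_b m n (f : mor m n) (i : 'I_m) : mor i (f i) :=
  @mkmor _ _ (fun j => Ordinal (gmor_b_subproof f j))
    (fun j j' h => @mor_lt _ _ f (widen_ord _ j) (widen_ord _ j') h).

Lemma gmor_aE m n (f : mor m n) (i : 'I_m) (j : 'I_(m - i.+1)) :
  gmor_a f i j = (f (tail j) - (f i).+1)%N :> nat.
Proof. by rewrite mkmorE. Qed.

Lemma gmor_bE m n (f : mor m n) (i : 'I_m) (j : 'I_i) :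
  gmor_b f i j = f (widen_ord (ltnW (ltn_ord i)) j) :> nat.
Proof. by rewrite mkmorE. Qed.

(* The summands of (Gamma_* V)_n are indexed by the s in [n]; the summand of
   index s is V_{n - s} for a and V_{s - 1} for b (here i = s - 1). *)
Definition gdeg n (i : 'I_n) : nat := if s is sa then (n - i.+1)%N else i.

Definition gmor m n (f : mor m n) (i : 'I_m) : mor (gdeg i) (gdeg (f i)) :=
  match s as s0 return mor (if s0 is sa then (m - i.+1)%N else i)
                           (if s0 is sa then (n - (f i).+1)%N else f i) with
  | sa => gmor_a f i
  | sb => gmor_b f i
  end.

Lemma gmor_id n (i : 'I_n) (j : 'I_(gdeg i)) : gmor (idm n) i j = j :> nat.
Proof.
rewrite /gmor; move: j; rewrite /gdeg; case: s => j.
  by rewrite gmor_aE !idmE addKn.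
by rewrite gmor_bE idmE.
Qed.

Lemma gmor_comp m n p (g : mor n p) (f : mor m n) (i : 'I_m) (j : 'I_(gdeg i)) :
  gmor (compm g f) i j = gmor g (f i) (gmor f i j) :> nat.
Proof.
rewrite /gmor; move: j; rewrite /gdeg; case: s => j.
  rewrite !gmor_aE !compmE; congr (nat_of_ord (g _) - _)%N.
  by apply: val_inj; rewrite /= gmor_aE subnKC //; apply: tail_gt.
rewrite !gmor_bE !compmE; congr (nat_of_ord (g _)).
by apply: val_inj; rewrite /= gmor_bE.
Qed.

Definition gobj (V : cmod k) n : lmodType k :=
  dsum (fun i : 'I_n => V (gdeg i)).

Definition ginj (V : cmod k) n (i : 'I_n) (v : V (gdeg i)) : gobj V n :=
  @dinj k n (fun i : 'I_n => V (gdeg i)) i v.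

Definition gact_fun (V : cmod k) m n (f : mor m n) (x : gobj V m) : gobj V n :=
  \sum_(i < m) ginj (cact V (gmor f i) (x i)).

Lemma gact_linear V m n (f : mor m n) : linear (@gact_fun V m n f).
Proof.
move=> a x y; rewrite /gact_fun scaler_sumr -big_split /=; apply: eq_bigr => i _.
by rewrite /ginj dsD dsZ !linearP.
Qed.

Definition gact V m n (f : mor m n) : {linear gobj V m -> gobj V n} :=
  mklin (@gact_linear V m n f).

Lemma ginj_cast V n d (i i' : 'I_n) (f : mor d (gdeg i)) (f' : mor d (gdeg i'))
    (v : V d) : i = i' -> (forall j, f j = f' j :> nat) ->
  ginj (cact V f v) = ginj (cact V f' v).
Proof.
move=> E; move: f f'; rewrite E => f f' ff'.
by have -> : f = f' by apply: mor_ext => j; apply: val_inj; apply: ff'.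
Qed.

Lemma gact_inj V m n (f : mor m n) i (v : V (gdeg i)) :
  gact V f (ginj v) = ginj (cact V (gmor f i) v).
Proof.
rewrite /= /gact_fun (bigD1 i) //= dinj_in big1 ?addr0 // => j ji.
by rewrite /ginj dinj_out 1?eq_sym // !linear0.
Qed.

Lemma gobj_decomp V n (x : gobj V n) : x = \sum_i ginj (x i).
Proof. exact: ds_decomp. Qed.

Lemma gobj_lin_ext V n (W : lmodType k) (f g : {linear gobj V n -> W}) :
  (forall i (v : V (gdeg i)), f (ginj v) = g (ginj v)) -> f =1 g.
Proof.
move=> fg x; rewrite (gobj_decomp x) !linear_sum; apply: eq_bigr => i _.
exact: fg.
Qed.

Lemma gact_id V n x : gact V (idm n) x = x.
Proof.
apply: (@gobj_lin_ext _ _ _ (gact V (idm n)) idfun) => i v.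
rewrite gact_inj /= -[v in RHS](cact_id).
apply: ginj_cast => [|j]; first by rewrite idmE.
by rewrite gmor_id idmE.
Qed.

Lemma gact_comp V m n p (g : mor n p) (f : mor m n) x :
  gact V (compm g f) x = gact V g (gact V f x).
Proof.
apply: (@gobj_lin_ext _ _ _ (gact V (compm g f)) (gact V g \o gact V f)).
move=> i v; rewrite -[RHS]/(gact V g (gact V f (ginj v))) !gact_inj -cact_comp.
apply: ginj_cast => [|j]; first by rewrite compmE.
by rewrite gmor_comp compmE.
Qed.

Definition Gamma_obj V : cmod k := CMod (@gact_id V) (@gact_comp V).

Definition gmap_fun V W (f : chom V W) n (x : gobj V n) : gobj W n :=
  [ffun i => f (gdeg i) (x i)].

Lemma gmap_linear V W (f : chom V W) n : linear (@gmap_fun V W f n).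
Proof.
by move=> a x y; apply/ffunP => i; rewrite dsD dsZ !ffunE linearP.
Qed.

Definition gmap V W (f : chom V W) n : {linear gobj V n -> gobj W n} :=
  mklin (@gmap_linear V W f n).

Lemma gmap_inj V W (f : chom V W) n i (v : V (gdeg i)) :
  gmap f n (ginj v) = ginj (f (gdeg i) v).
Proof.
apply/ffunP => j; rewrite ffunE; have [<-|ij] := eqVneq i j.
  by rewrite !dinj_in.
by rewrite /ginj !dinj_out // linear0.
Qed.

Lemma gmap_nat V W (f : chom V W) m n (a : mor m n) x :
  gmap f n (cact (Gamma_obj V) a x) = cact (Gamma_obj W) a (gmap f m x).
Proof.
apply: (@gobj_lin_ext _ _ _ (gmap f n \o gact V a) (gact W a \o gmap f m)).
move=> i v; rewrite -[LHS]/(gmap f n (gact V a (ginj v))).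
rewrite -[RHS]/(gact W a (gmap f m (ginj v))).
by rewrite gmap_inj !gact_inj gmap_inj cnat.
Qed.

Definition Gamma_map V W (f : chom V W) : chom (Gamma_obj V) (Gamma_obj W) :=
  @CHom k (Gamma_obj V) (Gamma_obj W) (gmap f) (gmap_nat f).

Lemma Gamma_id V : Gamma_map (chom_id V) = chom_id (Gamma_obj V).
Proof. by apply: chom_ext => n v; apply/ffunP => i; rewrite ffunE. Qed.

Lemma Gamma_comp U V W (g : chom V W) (f : chom U V) :
  Gamma_map (chom_comp g f) = chom_comp (Gamma_map g) (Gamma_map f).
Proof. by apply: chom_ext => n v; apply/ffunP => i; rewrite !ffunE. Qed.

Definition Gamma : cfunctor k := CFunctor Gamma_id Gamma_comp.
End Gamma.

Section Lim.
Variable k : pzRingType.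

Definition incl m n (h : (m <= n)%N) : mor m n :=
  @mkmor m n (widen_ord h) (fun i j ij => ij).

Lemma inclE m n (h : (m <= n)%N) i : incl h i = i :> nat.
Proof. by rewrite mkmorE. Qed.

Lemma incl_id n (h : (n <= n)%N) : incl h = idm n.
Proof. by apply: mor_ext => i; apply: val_inj; rewrite /= inclE idmE. Qed.

Lemma incl_comp m n p (h : (m <= n)%N) (h' : (n <= p)%N) (h'' : (m <= p)%N) :
  compm (incl h') (incl h) = incl h''.
Proof.
by apply: mor_ext => i; apply: val_inj; rewrite compmE /= !inclE.
Qed.

Lemma rho_b_incl n : rho sb n = incl (leqnSn n).
Proof.
by apply: mor_ext => i; apply: ord_inj; rewrite rho_lift val_lift_pole /= inclE.
Qed.

(* The direct limit of V_0 -> V_1 -> ... along the maps V(rho_b), i.e. along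
   the maps V(incl), see rho_b_incl and incl_comp. *)
Section Obj.
Variable V : cmod k.

Definition lim_rel (x y : {n : nat & V n}) : bool :=
  `[< exists N (hx : (tag x <= N)%N) (hy : (tag y <= N)%N),
      cact V (incl hx) (tagged x) = cact V (incl hy) (tagged y) >].

Lemma lim_rel_refl : reflexive lim_rel.
Proof. by move=> x; apply/asboolP; exists (tag x), (leqnn _), (leqnn _). Qed.

Lemma lim_rel_sym : symmetric lim_rel.
Proof.
have H x y : lim_rel x y -> lim_rel y x.
  by move=> /asboolP [N [hx [hy E]]]; apply/asboolP; exists N, hy, hx.
by move=> x y; apply/idP/idP; apply: H.
Qed.

Lemma incl_up m n p (h : (m <= n)%N) (h' : (n <= p)%N) (v : V m) :
  cact V (incl h') (cact V (incl h) v) = cact V (incl (leq_trans h h')) v.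
Proof. by rewrite -cact_comp (incl_comp h h' (leq_trans h h')). Qed.

Lemma lim_rel_trans : transitive lim_rel.
Proof.
move=> y x z /asboolP [N [hx [hy E]]] /asboolP [M [hy' [hz E']]].
apply/asboolP; exists (maxn N M).
exists (leq_trans hx (leq_maxl N M)), (leq_trans hz (leq_maxr N M)).
by rewrite -!incl_up E -E' !incl_up; congr (cact V (incl _) _);
  apply: bool_irrelevance.
Qed.

Definition lim_equiv : equiv_rel {n : nat & V n} :=
  EquivRel lim_rel lim_rel_refl lim_rel_sym lim_rel_trans.

Definition lim := {eq_quot lim_equiv}.

HB.instance Definition _ := Choice.on lim.

Definition lin n (v : V n) : lim := \pi_({eq_quot lim_equiv}) (Tagged (fun n => V n) v).

Lemma lin_eq m n (u : V m) (v : V n) :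
  lin u = lin v <-> exists N (hm : (m <= N)%N) (hn : (n <= N)%N),
    cact V (incl hm) u = cact V (incl hn) v.
Proof.
split; first by move=> /eqmodP /asboolP.
by move=> H; apply/eqmodP/asboolP.
Qed.

Lemma lin_incl m n (h : (m <= n)%N) (v : V m) : lin (cact V (incl h) v) = lin v.
Proof. by apply/lin_eq; exists n, (leqnn n), h; rewrite incl_id cact_id. Qed.

Definition lim_deg (x : lim) : nat := tag (repr (x : {eq_quot lim_equiv})).
Definition lim_rep (x : lim) : V (lim_deg x) :=
  tagged (repr (x : {eq_quot lim_equiv})).

Lemma lim_repK x : lin (lim_rep x) = x.
Proof. by rewrite -[RHS]reprK /lin /lim_rep /lim_deg; case: (repr _). Qed.

Lemma lim_surj (x : lim) : exists n (v : V n), x = lin v.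
Proof. by exists (lim_deg x), (lim_rep x); rewrite lim_repK. Qed.

Lemma lim_up N (x : lim) : exists n (h : (N <= n)%N) (v : V n), x = lin v.
Proof.
have [n [v ->]] := lim_surj x.
exists (maxn N n), (leq_maxl N n), (cact V (incl (leq_maxr N n)) v).
by rewrite lin_incl.
Qed.

Lemma lim_surj2 (x y : lim) : exists n (u v : V n), x = lin u /\ y = lin v.
Proof.
have [m [u ->]] := lim_surj x; have [n [h [v ->]]] := lim_up m y.
by exists n, (cact V (incl h) u), v; rewrite lin_incl.
Qed.

Lemma lim_surj3 (x y z : lim) :
  exists n (u v w : V n), [/\ x = lin u, y = lin v & z = lin w].
Proof.
have [m [u [v [-> ->]]]] := lim_surj2 x y; have [n [h [w ->]]] := lim_up m z.
by exists n, (cact V (incl h) u), (cact V (incl h) v), w; rewrite !lin_incl.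
Qed.

Definition lim_zero : lim := lin (0 : V 0).
Definition lim_opp (x : lim) : lim := lin (- lim_rep x).
Definition lim_scale (a : k) (x : lim) : lim := lin (a *: lim_rep x).
Definition lim_add (x y : lim) : lim :=
  lin (cact V (incl (leq_maxl (lim_deg x) (lim_deg y))) (lim_rep x) +
       cact V (incl (leq_maxr (lim_deg x) (lim_deg y))) (lim_rep y)).

Lemma lim_zeroE n : lim_zero = lin (0 : V n).
Proof. by apply/lin_eq; exists n, (leq0n n), (leqnn n); rewrite !linear0. Qed.

Lemma lim_oppE n (v : V n) : lim_opp (lin v) = lin (- v).
Proof.
have /lin_eq [N [h [h' E]]] := lim_repK (lin v).
by apply/lin_eq; exists N, h, h'; rewrite !linearN E.
Qed.

Lemma lim_scaleE a n (v : V n) : lim_scale a (lin v) = lin (a *: v).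
Proof.
have /lin_eq [N [h [h' E]]] := lim_repK (lin v).
by apply/lin_eq; exists N, h, h'; rewrite !linearZ /= E.
Qed.

Lemma incl_up_eq m n p N (h : (m <= n)%N) (h' : (n <= N)%N)
    (g : (m <= p)%N) (g' : (p <= N)%N) (v : V m) :
  cact V (incl h') (cact V (incl h) v) = cact V (incl g') (cact V (incl g) v).
Proof.
by rewrite !incl_up; congr (cact V (incl _) _); apply: bool_irrelevance.
Qed.

Lemma lim_addE n (u v : V n) : lim_add (lin u) (lin v) = lin (u + v).
Proof.
have /lin_eq [N [h [h' E]]] := lim_repK (lin u).
have /lin_eq [M [g [g' F]]] := lim_repK (lin v).
apply/lin_eq.
have hN := leq_maxl N M; have hM := leq_maxr N M.
have hmax : (maxn (lim_deg (lin u)) (lim_deg (lin v)) <= maxn N M)%N.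
  by rewrite geq_max (leq_trans h hN) (leq_trans g hM).
exists (maxn N M), hmax, (leq_trans h' hN); rewrite !linearD; congr (_ + _).
  by rewrite (incl_up_eq _ _ h hN) E incl_up.
rewrite (incl_up_eq _ _ g hM) F incl_up; congr (cact V (incl _) _).
exact: bool_irrelevance.
Qed.

Lemma lim_addA : associative lim_add.
Proof.
move=> x y z; have [n [u [v [w [-> -> ->]]]]] := lim_surj3 x y z.
by rewrite !lim_addE addrA.
Qed.

Lemma lim_addC : commutative lim_add.
Proof.
move=> x y; have [n [u [v [-> ->]]]] := lim_surj2 x y.
by rewrite !lim_addE addrC.
Qed.

Lemma lim_add0 : left_id lim_zero lim_add.
Proof.
by move=> x; have [n [u ->]] := lim_surj x;
  rewrite (lim_zeroE n) lim_addE add0r.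
Qed.

Lemma lim_addN : left_inverse lim_zero lim_opp lim_add.
Proof.
by move=> x; have [n [u ->]] := lim_surj x;
  rewrite (lim_zeroE n) lim_oppE lim_addE addNr.
Qed.

HB.instance Definition _ := GRing.isZmodule.Build lim
  lim_addA lim_addC lim_add0 lim_addN.

Lemma lim_scaleA a b x : lim_scale a (lim_scale b x) = lim_scale (a * b) x.
Proof. by have [n [u ->]] := lim_surj x; rewrite !lim_scaleE scalerA. Qed.

Lemma lim_scale1 : left_id 1 lim_scale.
Proof.
by move=> x; have [n [u ->]] := lim_surj x; rewrite !lim_scaleE scale1r.
Qed.

Lemma lim_scaleDr : right_distributive lim_scale +%R.
Proof.
move=> a x y; have [n [u [v [-> ->]]]] := lim_surj2 x y.
by rewrite -[lin u + lin v]/(lim_add _ _) -[_ + lim_scale a (lin v)]/(lim_add _ _)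
  lim_addE !lim_scaleE lim_addE scalerDr.
Qed.

Lemma lim_scaleDl x : {morph lim_scale^~ x : a b / a + b}.
Proof.
move=> a b; have [n [u ->]] := lim_surj x.
by rewrite -[_ + lim_scale b (lin u)]/(lim_add _ _)
  !lim_scaleE lim_addE scalerDl.
Qed.

HB.instance Definition _ := GRing.Zmodule_isLmodule.Build k lim
  lim_scaleA lim_scale1 lim_scaleDr lim_scaleDl.

Lemma lin_linear n : linear (@lin n).
Proof.
move=> a u v; rewrite -[_ + lin v]/(lim_add _ _) -[_ *: lin u]/(lim_scale _ _).
by rewrite lim_scaleE lim_addE.
Qed.

HB.instance Definition _ n := GRing.isLinear.Build k (V n) lim _ (@lin n)
  (@lin_linear n).
End Obj.

Section Map.
Variables (V W : cmod k) (f : chom V W).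

Definition lim_map_fun (x : lim V) : lim W := lin (f (lim_deg x) (lim_rep x)).

Lemma lim_map_funE n (v : V n) : lim_map_fun (lin v) = lin (f n v).
Proof.
have /lin_eq [N [h [h' E]]] := lim_repK (lin v).
by apply/lin_eq; exists N, h, h'; rewrite -!cnat E.
Qed.

Lemma lim_map_linear : linear lim_map_fun.
Proof.
move=> a x y; have [n [u [v [-> ->]]]] := lim_surj2 x y.
by rewrite -linearP !lim_map_funE !linearP.
Qed.

Definition lim_map : {linear lim V -> lim W} := mklin lim_map_linear.

Lemma lim_mapE n (v : V n) : lim_map (lin v) = lin (f n v).
Proof. exact: lim_map_funE. Qed.
End Map.

Lemma lim_map_id V x : lim_map (chom_id V) x = x.
Proof. by have [n [v ->]] := lim_surj x; rewrite lim_mapE. Qed.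

Lemma lim_map_comp (U V W : cmod k) (g : chom V W) (f : chom U V) x :
  lim_map (chom_comp g f) x = lim_map g (lim_map f x).
Proof. by have [n [v ->]] := lim_surj x; rewrite !lim_mapE. Qed.
End Lim.

Section Psi.
Variables (k : pzRingType) (s : side).
Implicit Types U V W : cmod k.

(* f on the first m points and the order isomorphism from the last r points to
   the last r points. *)
Definition glue_b_fun m n (f : mor m n) r (i : 'I_(m + r)) : 'I_(n + r) :=
  match split i with
  | inl j => lshift r (f j)
  | inr j => rshift n j
  end.

(* The identity on the first r points and f on the last m points. *)
Definition glue_a_fun m n (f : mor m n) r (i : 'I_(m + r)) : 'I_(n + r) :=
  cast_ord (addnC r n)
    match split (cast_ord (addnC m r) i) with
    | inl j => lshift n j
    | inr j => rshift r (f j)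
    end.

Lemma glue_b_lt m n (f : mor m n) r (i j : 'I_(m + r)) :
  (i < j)%N -> (glue_b_fun f i < glue_b_fun f j)%N.
Proof.
rewrite /glue_b_fun; case: splitP => i' ->; case: splitP => j' -> /=.
- exact: mor_lt.
- by move=> _; rewrite ltn_addr.
- by rewrite ltnNge ltnW // ltn_addr.
- by rewrite !ltn_add2l.
Qed.

Lemma glue_a_lt m n (f : mor m n) r (i j : 'I_(m + r)) :
  (i < j)%N -> (glue_a_fun f i < glue_a_fun f j)%N.
Proof.
rewrite /glue_a_fun /=.
case: splitP => i' /= ->; case: splitP => j' /= -> //=.
- by move=> _; rewrite ltn_addr.
- by rewrite ltnNge ltnW // ltn_addr.
- by rewrite !ltn_add2l; apply: mor_lt.
Qed.

(* The map V_{r + m} -> V_{r + n} through which f acts on Psi_*. *)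
Definition glue m n (f : mor m n) r : mor (m + r) (n + r) :=
  if s is sa then mkmor (@glue_a_lt m n f r) else mkmor (@glue_b_lt m n f r).

Lemma glue_b_lo m n (f : mor m n) r (i : 'I_(m + r)) (i' : 'I_m) :
  i = i' :> nat -> glue_b_fun f i = f i' :> nat.
Proof.
rewrite /glue_b_fun; case: splitP => j -> /= E.
  by congr (nat_of_ord (f _)); apply: ord_inj.
by have := ltn_ord i'; rewrite -E ltnNge leq_addr.
Qed.

Lemma glue_b_hi m n (f : mor m n) r (i : 'I_(m + r)) d :
  i = (m + d)%N :> nat -> glue_b_fun f i = (n + d)%N :> nat.
Proof.
rewrite /glue_b_fun; case: splitP => j -> /= E.
  by have := ltn_ord j; rewrite E ltnNge leq_addr.
by congr (_ + _)%N; apply/eqP; rewrite -(eqn_add2l m) E.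
Qed.

Lemma glue_a_lo m n (f : mor m n) r (i : 'I_(m + r)) :
  (i < r)%N -> glue_a_fun f i = i :> nat.
Proof.
rewrite /glue_a_fun /=; case: splitP => j /= -> // .
by rewrite ltnNge leq_addr.
Qed.

Lemma glue_a_hi m n (f : mor m n) r (i : 'I_(m + r)) (i' : 'I_m) :
  i = (r + i')%N :> nat -> glue_a_fun f i = (r + f i')%N :> nat.
Proof.
rewrite /glue_a_fun /=; case: splitP => j /= -> /eqP E.
  by have := ltn_ord j; rewrite (eqP E) ltnNge leq_addr.
congr (_ + nat_of_ord (f _))%N; apply: ord_inj; apply/eqP.
by rewrite -(eqn_add2l r).
Qed.

Lemma iota_pow_a_lo j m n (f : mor m n) (i : 'I_(j + m)) :
  (i < j)%N -> iota_pow sa j f i = i :> nat.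
Proof.
elim: j i => //= j IH i; case: (unliftP (pole sa (j + m)) i) => [i'|] ->.
  by rewrite iota_lift !val_lift_pole ltnS => /IH ->.
by rewrite iota_pole.
Qed.

Lemma iota_pow_a_hi j m n (f : mor m n) (i : 'I_(j + m)) (i' : 'I_m) :
  i = (j + i')%N :> nat -> iota_pow sa j f i = (j + f i')%N :> nat.
Proof.
elim: j i => [|j IH] i; first by move=> E; congr (nat_of_ord (f _)); apply: ord_inj.
rewrite [iota_pow _ _ _]/=; case: (unliftP (pole sa (j + m)) i) => [t|] -> //.
by rewrite iota_lift !val_lift_pole !addSn => -[] /IH ->.
Qed.

Lemma iota_pow_b_lo j m n (f : mor m n) (i : 'I_(j + m)) (i' : 'I_m) :
  i = i' :> nat -> iota_pow sb j f i = f i' :> nat.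
Proof.
elim: j i => [|j IH] i; first by move=> E; congr (nat_of_ord (f _)); apply: ord_inj.
rewrite [iota_pow _ _ _]/=; case: (unliftP (pole sb (j + m)) i) => [t|] ->.
  by rewrite iota_lift !val_lift_pole => /IH ->.
by move=> /= E; have := ltn_ord i'; rewrite -E ltnNge leq_addl.
Qed.

Lemma iota_pow_b_hi j m n (f : mor m n) (i : 'I_(j + m)) d :
  i = (m + d)%N :> nat -> iota_pow sb j f i = (n + d)%N :> nat.
Proof.
elim: j i => [|j IH] i.
  by move=> E; have := ltn_ord i; rewrite {1}E ltnNge leq_addr.
rewrite [iota_pow _ _ _]/=; case: (unliftP (pole sb (j + m)) i) => [t|] ->.
  by rewrite iota_lift !val_lift_pole => /IH ->.
rewrite iota_pole /= => E; suff -> : d = j by rewrite addnC.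
by apply/eqP; rewrite -(eqn_add2l m) -E addnC.
Qed.

Lemma lohi m r (i : 'I_(m + r)) :
  (exists i' : 'I_m, i = i' :> nat) \/
  (exists i' : 'I_r, i = (m + i')%N :> nat).
Proof. by case: (splitP i) => j E; [left|right]; exists j. Qed.

Lemma lohi' m r (i : 'I_(m + r)) :
  (exists i' : 'I_r, i = i' :> nat) \/
  (exists i' : 'I_m, i = (r + i')%N :> nat).
Proof. exact: (lohi (cast_ord (addnC m r) i)). Qed.

Lemma glue_iota m n (f : mor m n) r r' (g : mor r r') :
  compm (glue f r') (iota_pow (opp_side s) m g) =
  compm (iota_pow (opp_side s) n g) (glue f r).
Proof.
apply: mor_ext => i; apply: ord_inj; rewrite !compmE /glue; case: s; rewrite [opp_side _]/=.
  rewrite !mkmorE; case: (lohi' i) => -[i' E].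
    have E1 := iota_pow_b_lo g E; have E2 : glue_a_fun f i = i' :> nat.
      by rewrite glue_a_lo E.
    by rewrite glue_a_lo E1 // (iota_pow_b_lo g E2).
  have E1 := iota_pow_b_hi g E; have E2 := glue_a_hi f E.
  by rewrite (glue_a_hi f E1) (iota_pow_b_hi g E2).
rewrite !mkmorE; case: (lohi i) => -[i' E].
  have E1 : iota_pow sa m g i = i' :> nat by rewrite iota_pow_a_lo E.
  have E2 := glue_b_lo f E.
  by rewrite (glue_b_lo f E1) iota_pow_a_lo E2.
have E1 := iota_pow_a_hi g E; have E2 := glue_b_hi f E.
by rewrite (glue_b_hi f E1) (iota_pow_a_hi g E2).
Qed.

Lemma glue_id m r : glue (idm m) r = idm (m + r).
Proof.
apply: mor_ext => i; apply: ord_inj; rewrite idmE /glue; case: s; rewrite mkmorE.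
  case: (lohi' i) => -[i' E]; first by rewrite glue_a_lo E.
  by rewrite (glue_a_hi _ E) idmE E.
case: (lohi i) => -[i' E]; first by rewrite (glue_b_lo _ E) idmE E.
by rewrite (glue_b_hi _ E) E.
Qed.

Lemma glue_comp m n p (g : mor n p) (f : mor m n) r :
  glue (compm g f) r = compm (glue g r) (glue f r).
Proof.
apply: mor_ext => i; apply: ord_inj; rewrite compmE /glue; case: s; rewrite !mkmorE.
  case: (lohi' i) => -[i' E].
    have E1 : glue_a_fun f i = i' :> nat by rewrite glue_a_lo E.
    by rewrite !glue_a_lo ?E1 E.
  by rewrite (glue_a_hi _ (glue_a_hi f E)) (glue_a_hi _ E) compmE.
case: (lohi i) => -[i' E].
  by rewrite (glue_b_lo _ (glue_b_lo f E)) (glue_b_lo _ E) compmE.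
by rewrite (glue_b_hi _ (glue_b_hi f E)) (glue_b_hi _ E).
Qed.

Local Notation t := (opp_side s).

Lemma Spow_mor_nat V m n (f : mor m n) r r' (g : mor r r') (v : V (m + r)) :
  cact V (glue f r') (cact (Spow k t m V) g v) =
  cact (Spow k t n V) g (cact V (glue f r) v).
Proof. by rewrite /= -!cact_comp glue_iota. Qed.

Definition Spow_mor V m n (f : mor m n) : chom (Spow k t m V) (Spow k t n V) :=
  @CHom k (Spow k t m V) (Spow k t n V) (fun r => cact V (glue f r))
    (@Spow_mor_nat V m n f).

Lemma Spow_mor_id V n : Spow_mor V (idm n) = chom_id _.
Proof. by apply: chom_ext => r v; rewrite /= glue_id cact_id. Qed.

Lemma Spow_mor_comp V m n p (g : mor n p) (f : mor m n) :
  Spow_mor V (compm g f) = chom_comp (Spow_mor V g) (Spow_mor V f).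
Proof. by apply: chom_ext => r v; rewrite /= glue_comp cact_comp. Qed.

Lemma Spow_mor_map V W (h : chom V W) m n (f : mor m n) :
  chom_comp (Spow_mor W f) (fmap (Spow k t m) h) =
  chom_comp (fmap (Spow k t n) h) (Spow_mor V f).
Proof. by apply: chom_ext => r v; rewrite /= cnat. Qed.

(* Psi_a is built from D_b and S_b, and Psi_b from D_a and S_a, hence the
   opposite side t. *)
Definition AD : cfunctor k := compF (Coinv k) (Dfun k t).

Definition psi_act V m n (f : mor m n) :
    {linear lim (AD (Spow k t m V)) -> lim (AD (Spow k t n V))} :=
  lim_map (fmap AD (Spow_mor V f)).

Lemma psi_act_id V n x : psi_act V (idm n) x = x.
Proof. by rewrite /psi_act Spow_mor_id fmap_id lim_map_id. Qed.

Lemma psi_act_comp V m n p (g : mor n p) (f : mor m n) x :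
  psi_act V (compm g f) x = psi_act V g (psi_act V f x).
Proof. by rewrite /psi_act Spow_mor_comp fmap_comp lim_map_comp. Qed.

Definition Psi_obj V : cmod k :=
  @CMod k (fun n => lim (AD (Spow k t n V))) (@psi_act V)
    (@psi_act_id V) (@psi_act_comp V).

Definition psi_map V W (h : chom V W) n :
    {linear lim (AD (Spow k t n V)) -> lim (AD (Spow k t n W))} :=
  lim_map (fmap AD (fmap (Spow k t n) h)).

Lemma psi_map_nat V W (h : chom V W) m n (f : mor m n) x :
  psi_map h n (psi_act V f x) = psi_act W f (psi_map h m x).
Proof.
by rewrite /psi_map /psi_act -!lim_map_comp -!fmap_comp Spow_mor_map.
Qed.

Definition Psi_map V W (h : chom V W) : chom (Psi_obj V) (Psi_obj W) :=
  @CHom k (Psi_obj V) (Psi_obj W) (psi_map h) (@psi_map_nat V W h).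

Lemma Psi_id V : Psi_map (chom_id V) = chom_id (Psi_obj V).
Proof.
apply: chom_ext => n x; rewrite -[LHS]/(psi_map (chom_id V) n x) /psi_map.
by rewrite !fmap_id lim_map_id.
Qed.

Lemma Psi_comp U V W (g : chom V W) (f : chom U V) :
  Psi_map (chom_comp g f) = chom_comp (Psi_map g) (Psi_map f).
Proof.
apply: chom_ext => n x; rewrite -[LHS]/(psi_map (chom_comp g f) n x) /psi_map.
by rewrite !fmap_comp lim_map_comp.
Qed.

Definition Psi : cfunctor k := CFunctor Psi_id Psi_comp.
End Psi.

Section BFunctor.
Variables (k : pzRingType) (s : side).
Implicit Types U V W : cmod k.

Definition zmd : lmodType k := 'rV[k]_0.

Lemma zmd_eq (x y : zmd) : x = y.
Proof. by rewrite [LHS]thinmx0 [RHS]thinmx0. Qed.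

(* V_{n - 1}, with V_{-1} = 0 *)
Definition bobj V n : lmodType k := if n is n'.+1 then V n' else zmd.

Definition bact V m n : mor m n -> {linear bobj V m -> bobj V n} :=
  match m, n return mor m n -> {linear bobj V m -> bobj V n} with
  | m'.+1, n'.+1 => fun f =>
      if typeI s f then cact V (res_mor s f) else zlin (V m') (V n')
  | m, n => fun _ => zlin (bobj V m) (bobj V n)
  end.

Lemma bact_id V n x : bact V (idm n) x = x.
Proof.
case: n x => [|n] x; first exact: zmd_eq.
by rewrite /bact typeI_id res_id cact_id.
Qed.

Lemma bact_comp V m n p (g : mor n p) (f : mor m n) x :
  bact V (compm g f) x = bact V g (bact V f x).
Proof.
case: p g => [|p] g; first exact: zmd_eq.
case: m f x => [|m] f x; first by rewrite (zmd_eq x 0) !linear0.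
case: n g f => [|n] g f; first by have := mor_leq f.
rewrite /bact typeI_comp; case: (typeI s f) => /=; last by rewrite linear0.
by case: (_ == _); rewrite // res_comp cact_comp.
Qed.

Definition B_obj V : cmod k := CMod (@bact_id V) (@bact_comp V).

Definition bmap V W (f : chom V W) n : {linear bobj V n -> bobj W n} :=
  match n with
  | 0 => zlin zmd zmd
  | n'.+1 => f n'
  end.

Lemma bmap_nat V W (f : chom V W) m n (a : mor m n) x :
  bmap f n (bact V a x) = bact W a (bmap f m x).
Proof.
case: n a => [|n] a; first exact: zmd_eq.
case: m a x => [|m] a x; first by rewrite (zmd_eq x 0) !linear0.
by rewrite /bact; case: ifP => _; rewrite /= ?cnat ?linear0.
Qed.

Definition B_map V W (f : chom V W) : chom (B_obj V) (B_obj W) :=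
  @CHom k (B_obj V) (B_obj W) (bmap f) (@bmap_nat V W f).

Lemma B_id V : B_map (chom_id V) = chom_id (B_obj V).
Proof. by apply: chom_ext => -[|n] x //; apply: zmd_eq. Qed.

Lemma B_comp U V W (g : chom V W) (f : chom U V) :
  B_map (chom_comp g f) = chom_comp (B_map g) (B_map f).
Proof. by apply: chom_ext => -[|n] x //; apply: zmd_eq. Qed.

Definition Bfun : cfunctor k := CFunctor B_id B_comp.
End BFunctor.

Section QFunctor.
Variables (k : pzRingType) (s : side).
Implicit Types U V W : cmod k.

Definition qobj V n : lmodType k := (V n * bobj V n)%type.

Definition qsnd V m n : mor m n -> qobj V m -> bobj V n :=
  match n return mor m n -> qobj V m -> bobj V n with
  | 0 => fun _ _ => 0
  | n'.+1 => fun f x =>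
      match typeP s f with
      | left _ => bact s V f x.2
      | right fN => cact V (del_mor fN) x.1
      end
  end.

Definition qact_fun V m n (f : mor m n) (x : qobj V m) : qobj V n :=
  (cact V f x.1, qsnd f x).

Lemma qsnd_linear V m n (f : mor m n) a (x y : qobj V m) :
  qsnd f (a *: x + y) = a *: qsnd f x + qsnd f y.
Proof.
case: n f => [|n] f; first exact: zmd_eq.
rewrite /qsnd; case: typeP => fI; first exact: (linearP (bact s V f) a x.2 y.2).
exact: (linearP (cact V (del_mor fI)) a x.1 y.1).
Qed.

Lemma qact_linear V m n (f : mor m n) : linear (@qact_fun V m n f).
Proof.
by move=> a x y; congr (_, _); [exact: linearP | exact: qsnd_linear].
Qed.

Definition qact V m n (f : mor m n) : {linear qobj V m -> qobj V n} :=
  mklin (@qact_linear V m n f).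

Lemma qsnd_I V m n (f : mor m n) (x : qobj V m) :
  typeI s f -> qsnd f x = bact s V f x.2.
Proof.
case: n f => [|n] f fI; first exact: zmd_eq.
by rewrite /qsnd; case: typeP => // H; case/negP: H.
Qed.

Lemma qsnd_II V m n (f : mor m n.+1) (x : qobj V m) (fN : ~~ typeI s f) :
  qsnd f x = cact V (del_mor fN) x.1.
Proof.
rewrite /qsnd; case: typeP => H; first by case/negP: fN.
congr (cact V _ _); apply: mor_ext => i; apply: (@lift_inj _ (pole s n)).
by rewrite !del_lift.
Qed.

Lemma qact_id V n x : qact V (idm n) x = x.
Proof.
case: x => v w; congr (_, _); first exact: cact_id.
by rewrite -[LHS]/(qsnd (idm n) (v, w)) qsnd_I ?typeI_id // bact_id.
Qed.

Lemma qact_comp V m n p (g : mor n p) (f : mor m n) x :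
  qact V (compm g f) x = qact V g (qact V f x).
Proof.
case: x => v w; congr (_, _); first exact: cact_comp.
rewrite -[LHS]/(qsnd (compm g f) (v, w)).
rewrite -[RHS]/(qsnd g (cact V f v, qsnd f (v, w))).
case: (boolP (typeI s (compm g f))) => H.
  move: (H); rewrite typeI_comp => /andP [fI gI].
  by rewrite !qsnd_I // bact_comp.
case: p g H => [|p] g H; first exact: zmd_eq.
case: (boolP (typeI s g)) => gI.
  have fI : ~~ typeI s f by move: H; rewrite typeI_comp gI andbT.
  rewrite (qsnd_I _ gI) (qsnd_II _ H).
  case: n g f H gI fI => [|n] g f H gI fI; first by case/negP: fI; apply: typeI0.
  by rewrite (qsnd_II _ fI) (del_comp_r fI) cact_comp /bact gI.
by rewrite (qsnd_II _ gI) (qsnd_II _ H) (del_comp_l gI) cact_comp.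
Qed.

Definition Q_obj V : cmod k := CMod (@qact_id V) (@qact_comp V).

Definition qmor_fun V W (f : chom V W) n (x : qobj V n) : qobj W n :=
  (f n x.1, bmap f n x.2).

Lemma qmor_linear V W (f : chom V W) n : linear (@qmor_fun V W f n).
Proof. by move=> a x y; congr (_, _); rewrite linearP. Qed.

Definition qmor V W (f : chom V W) n : {linear qobj V n -> qobj W n} :=
  mklin (@qmor_linear V W f n).

Lemma qmor_nat V W (f : chom V W) m n (a : mor m n) x :
  qmor f n (qact V a x) = qact W a (qmor f m x).
Proof.
case: x => v w; congr (_, _); first exact: cnat.
case: n a => [|n] a; first exact: zmd_eq.
rewrite /= /qsnd; case: typeP => H; last exact: cnat.
exact: (bmap_nat _ f a w).
Qed.

Definition Q_map V W (f : chom V W) : chom (Q_obj V) (Q_obj W) :=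
  @CHom k (Q_obj V) (Q_obj W) (qmor f) (@qmor_nat V W f).

Lemma Q_id V : Q_map (chom_id V) = chom_id (Q_obj V).
Proof. by apply: chom_ext => -[|n] [v w] //; congr (_, _); apply: zmd_eq. Qed.

Lemma Q_comp U V W (g : chom V W) (f : chom U V) :
  Q_map (chom_comp g f) = chom_comp (Q_map g) (Q_map f).
Proof. by apply: chom_ext => -[|n] [v w] //; congr (_, _); apply: zmd_eq. Qed.

Definition Qfun : cfunctor k := CFunctor Q_id Q_comp.
End QFunctor.

Section RFunctor.
Variables (k : pzRingType) (s : side).
Implicit Types U V W : cmod k.

Definition robj V n : lmodType k := (V n * Kfun k s V n.+1)%type.

(* w |-> \partial^* alpha (w) if alpha is of type II, 0 if it is of type I *)
Definition rcorr V m n : mor m n -> {linear V m.+1 -> V n} :=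
  match n return mor m n -> {linear V m.+1 -> V n} with
  | 0 => fun _ => zlin (V m.+1) (V 0)
  | n'.+1 => fun f =>
      match typeP s f with
      | left _ => zlin (V m.+1) (V n'.+1)
      | right fN => cact V (add_mor fN)
      end
  end.

Definition ract_fun V m n (f : mor m n) (x : robj V m) : robj V n :=
  (cact V f x.1 - rcorr V f (kerval x.2), cact (Kfun k s V) (iota_mor s f) x.2).

Lemma ract_linear V m n (f : mor m n) : linear (@ract_fun V m n f).
Proof.
move=> a x y; congr (_, _); last exact: linearP.
rewrite -[RHS]/(a *: (cact V f x.1 - rcorr V f (kerval x.2)) +
  (cact V f y.1 - rcorr V f (kerval y.2))).
rewrite -[(a *: x + y).1]/(a *: x.1 + y.1) -[(a *: x + y).2]/(a *: x.2 + y.2).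
by rewrite !linearP scalerDr addrACA.
Qed.

Definition ract V m n (f : mor m n) : {linear robj V m -> robj V n} :=
  mklin (@ract_linear V m n f).

Lemma rcorr_I V m n (f : mor m n) v : typeI s f -> rcorr V f v = 0.
Proof.
case: n f => [|n] f fI //.
by rewrite /rcorr; case: typeP => // H; case/negP: H.
Qed.

Lemma rcorr_II V m n (f : mor m n.+1) v (fN : ~~ typeI s f) :
  rcorr V f v = cact V (add_mor fN) v.
Proof.
rewrite /rcorr; case: typeP => H; first by case/negP: fN.
congr (cact V _ v); apply: (@mor_extS s) => [|i];
  by rewrite ?add_pole ?add_lift.
Qed.

Lemma typeII_kill V m n (f : mor m n.+1) (v : V m) :
  ~~ typeI s f -> cact V (rho s m) v = 0 -> cact V f v = 0.
Proof.
by move=> fN Hv; rewrite -(rho_del fN) -rho_nat cact_comp Hv linear0.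
Qed.

Lemma ract_id V n x : ract V (idm n) x = x.
Proof.
case: x => v w; congr (_, _).
  by rewrite cact_id rcorr_I ?subr0 // typeI_id.
by rewrite iota_id cact_id.
Qed.

Lemma ract_comp V m n p (g : mor n p) (f : mor m n) x :
  ract V (compm g f) x = ract V g (ract V f x).
Proof.
case: x => v w; congr (_, _); last by rewrite iota_comp cact_comp.
rewrite /= linearB cact_comp -addrA -opprD; congr (_ - _).
set u := kerval w; have Hu : cact V (rho s m.+1) u = 0 by apply: kerval0.
clearbody u; case: (boolP (typeI s f)) => fI.
  rewrite (rcorr_I _ fI) linear0 add0r; case: (boolP (typeI s g)) => gI.
    by rewrite !rcorr_I // typeI_comp fI gI.
  case: p g gI => [|p] g gI; first by case/negP: gI; apply: typeI0.
  have H : ~~ typeI s (compm g f) by rewrite typeI_comp fI.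
  by rewrite !rcorr_II (add_comp_l gI) cact_comp.
case: p g => [|p] g.
  by case: n g f fI => [|n] g f fI;
    [case/negP: fI; apply: typeI0 | have := mor_leq g].
have H : ~~ typeI s (compm g f) by rewrite typeI_comp negb_and fI.
case: n g f fI H => [|n] g f fI H; first by case/negP: fI; apply: typeI0.
rewrite (rcorr_II _ H) (rcorr_II _ fI); case: (boolP (typeI s g)) => gI.
  by rewrite (rcorr_I _ gI) addr0 (add_comp_r gI fI) cact_comp.
have -> : cact V g (cact V (add_mor fI) u) = 0.
  by rewrite -cact_comp typeII_kill // typeI_comp negb_and gI orbT.
by rewrite add0r (rcorr_II _ gI) (add_comp_l gI) cact_comp.
Qed.

Definition R_obj V : cmod k := CMod (@ract_id V) (@ract_comp V).

Definition rmor_fun V W (f : chom V W) n (x : robj V n) : robj W n :=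
  (f n x.1, fmap (Kfun k s) f n.+1 x.2).

Lemma rmor_linear V W (f : chom V W) n : linear (@rmor_fun V W f n).
Proof. by move=> a x y; congr (_, _); rewrite linearP. Qed.

Definition rmor V W (f : chom V W) n : {linear robj V n -> robj W n} :=
  mklin (@rmor_linear V W f n).

Lemma rmor_nat V W (f : chom V W) m n (a : mor m n) x :
  rmor f n (ract V a x) = ract W a (rmor f m x).
Proof.
case: x => v w; congr (_, _); last exact: cnat.
rewrite /= linearB cnat; congr (_ - _).
case: n a => [|n] a; first by rewrite linear0.
by rewrite /rcorr; case: typeP => H; rewrite ?linear0 ?cnat.
Qed.

Definition R_map V W (f : chom V W) : chom (R_obj V) (R_obj W) :=
  @CHom k (R_obj V) (R_obj W) (rmor f) (@rmor_nat V W f).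

Lemma R_id V : R_map (chom_id V) = chom_id (R_obj V).
Proof.
by apply: chom_ext => n [v w]; congr (_, _); rewrite fmap_id.
Qed.

Lemma R_comp U V W (g : chom V W) (f : chom U V) :
  R_map (chom_comp g f) = chom_comp (R_map g) (R_map f).
Proof.
by apply: chom_ext => n [v w]; congr (_, _); rewrite fmap_comp.
Qed.

Definition Rfun : cfunctor k := CFunctor R_id R_comp.
End RFunctor.

(* Main.v *)
Require Import Defs.
From mathcomp Require Import all_boot all_order all_algebra.
From mathcomp Require Import boolp.

Set Implicit Arguments.
Unset Strict Implicit.
Unset Printing Implicit Defensive.
Import GRing.Theory.
Local Open Scope ring_scope.

(** The modules and functors are explicit, so each adjunction is proved by
    writing down the transposition and its inverse on elements; the side s is
    kept as a parameter, and only the combinatorics of intervals splits into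
    two cases.

    Each shift functor is governed by the dichotomy between morphisms of type
    I, which preserve the pole and hence are iota_mor of their restriction
    (iota_res), and morphisms of type II, which factor through rho (rho_del).
    With h denoting a morphism out of the left adjoint, the transposes are
      - Gamma V -> W :  v |-> h (v in the summand at the pole of Gamma);
      - S V -> W :      v |-> (h (rho v), h v);
      - Q V -> W :      v |-> (h (v, 0), h (0, v)), where h (0, v) is killed
                        by rho since rho kills (0, v);
      - D V -> W :      v |-> h (class of v);
      - B V -> W :      v |-> h v, killed by rho since rho kills B V.
    The isomorphism of S B with the identity and that of K Q with B are read
    off from the definitions. The isomorphism of D Gamma with the identity is
    formal: D Gamma is left adjoint to S B, and left adjoints are unique
    (left_adjoint_unique).

    The substantial adjunction is that of Psi and Gamma. A point i of [N]
    splits [N] into two intervals: one whose length n is the degree of the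
    summand of index i of Gamma(W)_N, and another one of length r, with
    N = n + r + 1. An element v of V_N thus has a class in Psi(V)_n, the
    direct limit over r of the coinvariants of D S^n V. A morphism h from Psi
    V to W corresponds to the morphism from V to Gamma W whose component at i
    is h of this class. That this is natural is the content of two facts
    about an increasing map f. If f misses the point j, then it factors
    through the inclusion of the complement of j, so the class at j of f v is
    zero in the cokernel D (rho_factor). If j = f i, then f splits into its
    restrictions to the two intervals; the one on n points is the action on
    Psi and Gamma, and the one on r points becomes invisible in the
    coinvariants and the limit (glue_factor). Conversely a morphism g from V
    to Gamma W determines h on the class of v as the component of g v at the
    middle point, and the same two facts show that this is well defined. *)

(** * Composition and uniqueness of adjoints *)

Section Adjoints.
Variable k : pzRingType.
Implicit Types (F G : cfunctor k) (U V W : cmod k).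

Lemma chom_compA U V W X (h : chom W X) (g : chom V W) (f : chom U V) :
  chom_comp h (chom_comp g f) = chom_comp (chom_comp h g) f.
Proof. exact: chom_ext. Qed.

Lemma chom_comp1 V W (f : chom V W) : chom_comp f (chom_id V) = f.
Proof. exact: chom_ext. Qed.

Lemma chom_1comp V W (f : chom V W) : chom_comp (chom_id W) f = f.
Proof. exact: chom_ext. Qed.

Lemma left_adjoint_id : left_adjoint (idF k) (idF k).
Proof.
exists (fun V W h => h); split=> [V W|V V' W W' f g h]; first by exists id.
by [].
Qed.

Lemma left_adjoint_comp F G F' G' :
  left_adjoint F G -> left_adjoint F' G' ->
  left_adjoint (compF F F') (compF G' G).
Proof.
move=> [phi [phiB phiN]] [phi' [phiB' phiN']].
exists (fun V W h => phi' V (G W) (phi (F' V) W h)); split=> [V W|V V' W W' f g h].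
  exact: bij_comp (phiB' _ _) (phiB _ _).
by rewrite /= phiN phiN'.
Qed.

Lemma left_adjoint_iso F G G' :
  left_adjoint F G -> nat_iso G G' -> left_adjoint F G'.
Proof.
move=> [phi [phiB phiN]] [eta [theta [etaN [thetaK etaK]]]].
exists (fun V W h => chom_comp (eta W) (phi V W h)).
split=> [V W|V V' W W' f g h]; last first.
  by rewrite phiN 2!chom_compA etaN -!chom_compA.
have [psi phiK psiK] := phiB V W.
exists (fun h => psi (chom_comp (theta W) h)) => h.
  by rewrite chom_compA thetaK chom_1comp phiK.
by rewrite psiK chom_compA etaK chom_1comp.
Qed.

(** The Yoneda argument: the component F V -> F' V corresponds, under the
    first adjunction, to the unit V -> G F' V of the second one, and
    symmetrically. Classical choice turns the bijectivity of the transposition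
    into an inverse chosen for every V. *)
Lemma left_adjoint_unique F F' G :
  left_adjoint F G -> left_adjoint F' G -> nat_iso F F'.
Proof.
move=> [phi [phiB phiN]] [phi' [phiB' phiN']].
have eP V : {e : chom (F V) (F' V) | phi V (F' V) e = phi' V (F' V) (chom_id _)}.
  apply: cid; have [psi _ psiK] := phiB V (F' V).
  by exists (psi (phi' V (F' V) (chom_id _))); rewrite psiK.
have tP V : {e : chom (F' V) (F V) | phi' V (F V) e = phi V (F V) (chom_id _)}.
  apply: cid; have [psi _ psiK] := phiB' V (F V).
  by exists (psi (phi V (F V) (chom_id _))); rewrite psiK.
have nl V W W' (g : chom W W') (h : chom (F V) W) :
    phi V W' (chom_comp g h) = chom_comp (fmap G g) (phi V W h).
  by have := phiN V V W W' (chom_id V) g h; rewrite fmap_id !chom_comp1.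
have nl' V W W' (g : chom W W') (h : chom (F' V) W) :
    phi' V W' (chom_comp g h) = chom_comp (fmap G g) (phi' V W h).
  by have := phiN' V V W W' (chom_id V) g h; rewrite fmap_id !chom_comp1.
have nr V V' W (f : chom V' V) (h : chom (F V) W) :
    phi V' W (chom_comp h (fmap F f)) = chom_comp (phi V W h) f.
  by have := phiN V V' W W f (chom_id W) h; rewrite fmap_id !chom_1comp.
have nr' V V' W (f : chom V' V) (h : chom (F' V) W) :
    phi' V' W (chom_comp h (fmap F' f)) = chom_comp (phi' V W h) f.
  by have := phiN' V V' W W f (chom_id W) h; rewrite fmap_id !chom_1comp.
exists (fun V => sval (eP V)), (fun V => sval (tP V)); split; [|split].
- move=> V W f; apply: (bij_inj (phiB V (F' W))).
  rewrite nr nl (svalP (eP W)) (svalP (eP V)) -nl' -nr'.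
  by rewrite chom_1comp chom_comp1.
- move=> V; apply: (bij_inj (phiB V (F V))).
  by rewrite nl (svalP (eP V)) -nl' chom_comp1 (svalP (tP V)).
- move=> V; apply: (bij_inj (phiB' V (F' V))).
  by rewrite nl' (svalP (tP V)) -nl chom_comp1 (svalP (eP V)).
Qed.

Lemma nat_iso_sym F G : nat_iso F G -> nat_iso G F.
Proof.
move=> [eta [theta [etaN [thetaK etaK]]]]; exists theta, eta; split=> // V W f.
rewrite -[LHS]chom_comp1 -(etaK V) chom_compA -(chom_compA _ _ (eta V)) -etaN.
by rewrite !chom_compA thetaK chom_1comp.
Qed.

Lemma nat_iso_trans F G H : nat_iso F G -> nat_iso G H -> nat_iso F H.
Proof.
move=> [eta [theta [etaN [thetaK etaK]]]] [eta' [theta' [etaN' [thetaK' etaK']]]].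
exists (fun V => chom_comp (eta' V) (eta V)).
exists (fun V => chom_comp (theta V) (theta' V)); split; [|split] => [V W f|V|V].
- by rewrite -chom_compA etaN chom_compA etaN' -chom_compA.
- by rewrite -chom_compA (chom_compA (theta' V)) thetaK' chom_1comp thetaK.
- by rewrite -chom_compA (chom_compA (eta V)) etaK chom_1comp etaK'.
Qed.
End Adjoints.

(** Every adjunction below comes with an explicit inverse transposition, so
    that only one naturality square, read on elements, remains. *)
Lemma left_adjoint_intro (k : pzRingType) (F G : cfunctor k)
    (phi : forall V W, chom (F V) W -> chom V (G W))
    (psi : forall V W, chom V (G W) -> chom (F V) W) :
  (forall V W h, psi V W (phi V W h) = h) ->
  (forall V W g, phi V W (psi V W g) = g) ->
  (forall V V' W W' (f : chom V' V) (g : chom W W') (h : chom (F V) W) n v,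
     phi V' W' (chom_comp g (chom_comp h (fmap F f))) n v =
     fmap G g n (phi V W h n (f n v))) ->
  left_adjoint F G.
Proof.
move=> phiK psiK phiN; exists phi; split=> [V W|V V' W W' f g h].
  by exists (psi V W).
by apply: chom_ext => n v; rewrite phiN.
Qed.

(** * Linear maps out of a quotient *)

Section QuotLift.
Variables (k : pzRingType) (U X : lmodType k) (P : submod U) (f : {linear U -> X}).
Hypothesis fP : forall x, P x -> f x = 0.

Definition qlift_fun (u : quotmod P) : X := f (repr (u : Quotient.quot (Defs.subpred P))).

Lemma qlift_funE x : qlift_fun (qpi P x) = f x.
Proof.
apply/eqP; rewrite -subr_eq0 -linearB; apply/eqP/fP/qpiP.
by rewrite /qpi reprK.
Qed.

Lemma qlift_linear : linear qlift_fun.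
Proof.
move=> a u v; have [x ->] := qpi_surj u; have [y ->] := qpi_surj v.
by rewrite -linearP !qlift_funE linearP.
Qed.

Definition qlift : {linear quotmod P -> X} := mklin qlift_linear.

Lemma qliftE x : qlift (qpi P x) = f x. Proof. exact: qlift_funE. Qed.
End QuotLift.

(** * Rigidity of increasing maps *)

Section Morphisms.

Lemma mor_ge m n (f : mor m n) (i : 'I_m) : (i <= f i)%N.
Proof.
case: i => i; elim: i => // i IH lti.
by apply: leq_ltn_trans (IH (ltnW lti)) _; apply: mor_lt => /=.
Qed.

Lemma mor_le n (f : mor n n) (i : 'I_n) : (f i <= i)%N.
Proof.
suff H d (j : 'I_n) : (j + d.+1 = n -> f j + d < n)%N.
  rewrite -ltnS -(ltn_add2r (n - i.+1)) subnKC //.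
  by apply: H; rewrite addnS -addSn subnKC.
elim: d j => [|d IH] j E; first by rewrite addn0.
have ltj : (j.+1 < n)%N by rewrite -[ltnRHS]E !addnS !ltnS leq_addr.
have := IH (Ordinal ltj); rewrite /= addSnnS => /(_ E).
apply: leq_ltn_trans; rewrite -addSnnS leq_add2r.
exact: mor_lt.
Qed.

Lemma mor_val m n (f : mor m n) (i : 'I_m) : m = n -> f i = i :> nat.
Proof.
by move=> E; move: f; rewrite -E => f; apply/eqP; rewrite eqn_leq mor_le mor_ge.
Qed.

(** There is a single increasing map between two chains of the same length.
    This settles all the identities between casts below: the summand degrees
    of Gamma and the indices of Psi agree with the expected numbers only
    propositionally, so one moves between them along incl, and any composite
    of such casts that ends where it started acts as the identity. *)
Lemma mor_endo m n (f g : mor m n) : m = n -> f = g.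
Proof. by move=> E; apply: mor_ext => i; apply: val_inj; rewrite /= !mor_val. Qed.

Lemma act_endo k (V : cmod k) n (f : mor n n) (v : V n) : cact V f v = v.
Proof. by rewrite (mor_endo f (idm n)) // cact_id. Qed.

Lemma mor_mono m n (f : mor m n) i j : (f i < f j)%N = (i < j)%N.
Proof.
apply/idP/idP; last exact: mor_lt.
rewrite !ltnNge; apply: contra.
by rewrite leq_eqVlt => /orP[/eqP/ord_inj->//|/(mor_lt f)/ltnW].
Qed.

(** The preimages are chosen pointwise; since g reflects the order, the choice
    is increasing. *)
Lemma mor_factor m n p (f : mor m p) (g : mor n p) :
  (forall i, exists j, g j = f i) -> exists h : mor m n, f = compm g h.
Proof.
move=> /choice [h gh].
have h_lt (i j : 'I_m) : (i < j)%N -> (h i < h j)%N by rewrite -(mor_mono g) !gh mor_mono.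
by exists (mkmor h_lt); apply: mor_ext => i; rewrite compmE mkmorE gh.
Qed.
End Morphisms.

(** * Type I and type II morphisms *)

Section ShiftAdjunctions.
Variables (k : pzRingType) (s : side).
Implicit Types U V W : cmod k.

Lemma iota_res m n (f : mor m.+1 n.+1) : typeI s f -> iota_mor s (res_mor s f) = f.
Proof.
move=> /eqP fI; apply: (@mor_extS s) => [|i]; first by rewrite iota_pole fI.
by rewrite iota_lift res_lift.
Qed.

Lemma typeI_iota m n (f : mor m n) : typeI s (iota_mor s f).
Proof. by rewrite /= iota_pole. Qed.

Lemma res_iota m n (f : mor m n) : res_mor s (iota_mor s f) = f.
Proof.
by apply: mor_ext => i; apply: (@lift_inj _ (pole s n)); rewrite res_lift iota_lift.
Qed.

(** The morphism rho misses the pole. Hence it acts by zero on B V, and on Q V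
    it copies the first coordinate into the second one. *)
Lemma rho_II n : ~~ typeI s (rho s n).
Proof.
case: n => // n /=; rewrite rho_lift; exact: lift_pole_neq.
Qed.

Lemma bact_iota V m n (f : mor m n) (v : V m) :
  bact s V (iota_mor s f) v = cact V f v.
Proof. by rewrite /bact typeI_iota res_iota. Qed.

Lemma bact_I V m n (f : mor m.+1 n.+1) (v : V m) :
  typeI s f -> bact s V f v = cact V (res_mor s f) v.
Proof. by rewrite /bact => ->. Qed.

Lemma bact_II V m n (f : mor m n) v : ~~ typeI s f -> bact s V f v = 0.
Proof.
case: n f => [|n] f fI; first exact: zmd_eq.
by case: m f v fI => [|m] f v fI //; rewrite /bact (negPf fI).
Qed.

Lemma nat_iso_SB : nat_iso (compF (Sfun k s) (Bfun k s)) (idF k).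
Proof.
have E V m n (f : mor m n) (v : V m) :
    cact (compF (Sfun k s) (Bfun k s) V) f v = cact V f v.
  exact: bact_iota.
exists (fun V => @CHom k (compF (Sfun k s) (Bfun k s) V) (idF k V)
  (fun n => idfun : {linear V n -> V n}) (E V)).
exists (fun V => @CHom k (idF k V) (compF (Sfun k s) (Bfun k s) V)
  (fun n => idfun : {linear V n -> V n}) (fun m n f v => esym (E V m n f v))).
by split; [|split] => *; apply: chom_ext.
Qed.

(** * S is left adjoint to Q *)

Lemma act_rho V m n (f : mor m n) (v : V m) :
  cact V (iota_mor s f) (cact V (rho s m) v) = cact V (rho s n) (cact V f v).
Proof. by rewrite -!cact_comp rho_nat. Qed.

Lemma act_del V m n (f : mor m n.+1) (fN : ~~ typeI s f) (v : V m) :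
  cact V (rho s n) (cact V (del_mor fN) v) = cact V f v.
Proof. by rewrite -cact_comp rho_del. Qed.

Section SQ.
Variables V W : cmod k.

Section To.
Variable h : chom (Sfun k s V) W.

Definition trSQ_snd n : {linear V n -> bobj W n} :=
  match n with 0 => zlin (V 0) (bobj W 0) | n'.+1 => h n' end.

(** An element v of V_n is seen in two ways by h : S V -> W: its image rho v
    lies in V_{n+1} = (S V)_n, and v itself lies in (S V)_{n-1}. These are the
    two coordinates of Q W. Along a type II map f = rho o del f, and the
    naturality of h at del f turns the first one into the second. *)
Definition trSQ_fun n (v : V n) : qobj W n := (h n (cact V (rho s n) v), trSQ_snd n v).

Lemma trSQ_linear n : linear (@trSQ_fun n).
Proof. by move=> a x y; congr (_, _); rewrite !linearP. Qed.

Lemma trSQ_nat m n (f : mor m n) (v : V m) :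
  mklin (@trSQ_linear n) (cact V f v) = cact (Qfun k s W) f (mklin (@trSQ_linear m) v).
Proof.
congr (_, _); first by rewrite -act_rho (cnat h f).
rewrite -[RHS]/(qsnd s f (trSQ_fun v)).
case: n f => [|n] f; first exact: zmd_eq.
case: (boolP (typeI s f)) => fI; last first.
  rewrite (qsnd_II _ fI) /= -(act_del fI) -act_rho.
  exact: (cnat h (del_mor fI)).
rewrite (qsnd_I _ fI); case: m f v fI => [|m] f v fI //.
by rewrite (bact_I _ fI) -[in LHS](iota_res fI) (cnat h (res_mor s f)).
Qed.

Definition trSQ : chom V (Qfun k s W) := @CHom k V (Qfun k s W) _ trSQ_nat.
End To.

Section From.
Variable g : chom V (Qfun k s W).

Lemma invSQ_linear n : linear (fun v : V n.+1 => (g n.+1 v).2 : W n).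
Proof. by move=> a x y; rewrite linearP. Qed.

Lemma invSQ_nat m n (f : mor m n) (v : Sfun k s V m) :
  mklin (@invSQ_linear n) (cact (Sfun k s V) f v) = cact W f (mklin (@invSQ_linear m) v).
Proof.
rewrite /= cnat -[LHS]/(qsnd s (iota_mor s f) (g m.+1 v)).
by rewrite qsnd_I ?typeI_iota // bact_iota.
Qed.

Definition invSQ : chom (Sfun k s V) W := @CHom k (Sfun k s V) W _ invSQ_nat.
End From.

Lemma trSQ_can h : invSQ (trSQ h) = h.
Proof. exact: chom_ext. Qed.

(** The first coordinate of g is recovered from the second one because rho
    acts on Q by (v, w) |-> (rho v, v). *)
Lemma invSQ_can g : trSQ (invSQ g) = g.
Proof.
apply: chom_ext => n v; rewrite [RHS]surjective_pairing.
congr (_, _); last by case: n v => [|n] v //; exact: zmd_eq.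
rewrite /= cnat -[LHS]/(qsnd s (rho s n) (g n v)).
by rewrite (qsnd_II _ (rho_II n)) act_endo.
Qed.
End SQ.

Lemma adjoint_S_Q : left_adjoint (Sfun k s) (Qfun k s).
Proof.
apply: (left_adjoint_intro trSQ_can invSQ_can) => V V' W W' f g h [|n] v;
  rewrite /= /trSQ_fun /qmor_fun; congr (_, _); rewrite //= -?cnat //.
Qed.

(** * Q is left adjoint to R *)

Section QR.
Variables V W : cmod k.

Definition qinl n (v : V n) : Qfun k s V n := (v, 0).
Definition qinr n (v : V n) : Qfun k s V n.+1 := (0, v).

Lemma qinl_linear n : linear (@qinl n).
Proof.
by move=> a x y; congr (_, _); rewrite -[RHS]/(a *: 0 + 0) scaler0 addr0.
Qed.

Lemma qinr_linear n : linear (@qinr n).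
Proof.
by move=> a x y; congr (_, _); rewrite -[RHS]/(a *: 0 + 0) scaler0 addr0.
Qed.

Lemma act_qinr m n (f : mor m.+1 n.+1) (v : V m) :
  typeI s f -> cact (Qfun k s V) f (qinr v) = qinr (cact V (res_mor s f) v).
Proof.
move=> fI; congr (_, _); first exact: linear0.
by rewrite -[LHS]/(qsnd s f (qinr v)) qsnd_I //= bact_I.
Qed.

Lemma act_qinr_II m n (f : mor m.+1 n.+1) (v : V m) :
  ~~ typeI s f -> cact (Qfun k s V) f (qinr v) = 0.
Proof.
move=> fI; congr (_, _); first exact: linear0.
by rewrite -[LHS]/(qsnd s f (qinr v)) (qsnd_II _ fI) linear0.
Qed.

Lemma act_qinl m n (f : mor m n) (v : V m) :
  typeI s f -> cact (Qfun k s V) f (qinl v) = qinl (cact V f v).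
Proof.
by move=> fI; congr (_, _); rewrite -[LHS]/(qsnd s f (qinl v)) qsnd_I //= linear0.
Qed.

(** The failure of V -> Q V to be natural along type II maps; the correction
    in R cancels it. *)
Lemma act_qinl_II m n (f : mor m n.+1) (v : V m) (fN : ~~ typeI s f) :
  cact (Qfun k s V) f (qinl v) = qinl (cact V f v) + qinr (cact V (del_mor fN) v).
Proof.
congr (_, _); first by rewrite addr0.
by rewrite -[LHS]/(qsnd s f (qinl v)) (qsnd_II _ fN) add0r.
Qed.

Lemma typeI_add m n (f : mor m n.+1) (fN : ~~ typeI s f) : typeI s (add_mor fN).
Proof. by rewrite /= add_pole. Qed.

Lemma res_add m n (f : mor m n.+1) (fN : ~~ typeI s f) :
  res_mor s (add_mor fN) = del_mor fN.
Proof.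
apply: mor_ext => i; apply: (@lift_inj _ (pole s n)).
by rewrite res_lift add_lift del_lift.
Qed.

Section To.
Variable h : chom (Qfun k s V) W.

Lemma trQR_ker n (v : V n) : h n.+1 (qinr v) \in kerp (cact W (rho s n.+1)).
Proof.
by apply/eqP; rewrite -cnat act_qinr_II ?linear0 //; apply: rho_II.
Qed.

(** The second coordinate lies in the kernel of rho since the type II map rho
    kills the summand qinr of Q V. *)
Definition trQR_fun n (v : V n) : robj s W n := (h n (qinl v), KerMod (trQR_ker v)).

Lemma trQR_linear n : linear (@trQR_fun n).
Proof.
move=> a x y; congr (_, _); first by rewrite qinl_linear linearP.
by apply: val_inj; rewrite linearP /= qinr_linear linearP.
Qed.

(** In the type II case h (qinr (del f v)) is the correction add f (h (qinr
    v)), because add f is of type I and restricts to del f. *)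
Lemma trQR_nat m n (f : mor m n) (v : V m) :
  mklin (@trQR_linear n) (cact V f v) = cact (Rfun k s W) f (mklin (@trQR_linear m) v).
Proof.
congr (_, _); last first.
  apply: val_inj => /=; rewrite -cnat act_qinr ?typeI_iota //.
  by rewrite res_iota.
rewrite -[RHS]/(cact W f (h m (qinl v)) - rcorr s W f (h m.+1 (qinr v))) -cnat.
case: (boolP (typeI s f)) => fI.
  by rewrite rcorr_I // subr0 act_qinl.
case: n f fI => [|n] f fI; first by case/negP: fI; apply: typeI0.
rewrite (rcorr_II _ fI) -cnat (act_qinl_II v fI) linearD.
by rewrite act_qinr ?typeI_add // res_add addrK.
Qed.

Definition trQR : chom V (Rfun k s W) := @CHom k V (Rfun k s W) _ trQR_nat.
End To.

Section From.
Variable g : chom V (Rfun k s W).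

Lemma invQR_snd_linear n : linear (fun x : V n => kerval (g n x).2 : W n.+1).
Proof. by move=> a x y; rewrite linearP; apply: kerval_linear. Qed.

Definition invQR_snd n : {linear bobj V n -> W n} :=
  match n with
  | 0 => zlin (bobj V 0) (W 0)
  | n'.+1 => mklin (@invQR_snd_linear n')
  end.

Definition invQR_fun n (x : qobj V n) : W n := (g n x.1).1 + invQR_snd n x.2.

Lemma invQR_linear n : linear (@invQR_fun n).
Proof.
move=> a x y; rewrite /invQR_fun !linearP /= scalerDr !addrA; congr (_ + _).
by rewrite addrAC.
Qed.

Lemma cnat_R_fst m n (f : mor m n) (v : V m) :
  (g n (cact V f v)).1 = cact W f (g m v).1 - rcorr s W f (kerval (g m v).2).
Proof. by rewrite cnat. Qed.

Lemma cnat_R_snd m n (f : mor m n) (v : V m) :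
  kerval (g n (cact V f v)).2 = cact W (iota_mor s f) (kerval (g m v).2).
Proof. by rewrite cnat. Qed.

(** In the type II case the two correction terms cancel: add f is equal to
    iota (del f). What remains is f applied to an element of K W, which is
    zero since f factors through rho. *)
Lemma invQR_nat m n (f : mor m n) (x : Qfun k s V m) :
  mklin (@invQR_linear n) (cact (Qfun k s V) f x) = cact W f (mklin (@invQR_linear m) x).
Proof.
rewrite -[LHS]/((g n (cact V f x.1)).1 + invQR_snd n (qsnd s f x)) cnat_R_fst.
rewrite -[RHS]/(cact W f ((g m x.1).1 + invQR_snd m x.2)) linearD -addrA.
congr (_ + _); case: (boolP (typeI s f)) => fI.
  rewrite rcorr_I // oppr0 add0r qsnd_I //.
  case: n f fI => [|n] f fI; first by case: m f x fI => [|m] f x fI;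
    [rewrite !linear0 | have := mor_leq f].
  case: m f x fI => [|m] f x fI //=.
  by rewrite bact_I // cnat_R_snd iota_res.
case: n f fI => [|n] f fI; first by case/negP: fI; apply: typeI0.
rewrite (rcorr_II _ fI) (qsnd_II _ fI) /= cnat_R_snd -(res_add fI).
rewrite iota_res ?typeI_add // addNr.
case: m f x fI => [|m] f x fI; first by rewrite linear0.
by rewrite /= (typeII_kill fI (kerval0 _)).
Qed.

Definition invQR : chom (Qfun k s V) W := @CHom k (Qfun k s V) W _ invQR_nat.
End From.

Lemma trQR_can h : invQR (trQR h) = h.
Proof.
apply: chom_ext => n [v w].
rewrite -[LHS]/(h n (qinl v) + invQR_snd (trQR h) n w).
have -> : (v, w) = qinl v + (0, w) :> Qfun k s V n.
  by congr (_, _); rewrite -?[RHS]/(_ + _) ?addr0 ?add0r.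
rewrite linearD; congr (_ + _); case: n v w => [|n] v w //.
by rewrite (zmd_eq w 0) !linear0.
Qed.

Lemma invQR_can g : trQR (invQR g) = g.
Proof.
apply: chom_ext => n v; rewrite [RHS]surjective_pairing.
congr (_, _); first by rewrite /= /invQR_fun /= linear0 addr0.
by apply: val_inj; rewrite /= /invQR_fun /= linear0 add0r.
Qed.
End QR.

Lemma adjoint_Q_R : left_adjoint (Qfun k s) (Rfun k s).
Proof.
apply: (left_adjoint_intro trQR_can invQR_can) => V V' W W' f g h n v.
congr (_, _); last apply: val_inj; congr (g _ (h _ _)); congr (_, _).
- by case: n v => [|n] v //=; rewrite linear0.
- by rewrite /= linear0.
Qed.

(** * D is left adjoint to B *)

Section DB.
Variables V W : cmod k.

Definition dpi n (v : V n.+1) : Dfun k s V n := qpi (immod (cact V (rho s n))) v.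

Lemma dpi_linear n : linear (@dpi n).
Proof. exact: qpi_linear. Qed.

Lemma dpi0 n (v : V n) : dpi (cact V (rho s n) v) = 0.
Proof. by rewrite -(linear0 (qpi _)); apply/qpiP; rewrite subr0; exists v. Qed.

Lemma act_dpi m n (f : mor m n) (v : V m.+1) :
  cact (Dfun k s V) f (dpi v) = dpi (cact V (iota_mor s f) v).
Proof. exact: qmapE. Qed.

Section To.
Variable h : chom (Dfun k s V) W.

Lemma trDB_linear n : linear (fun v : V n.+1 => h n (dpi v)).
Proof. by move=> a x y; rewrite dpi_linear linearP. Qed.

Definition trDB_fun n : {linear V n -> bobj W n} :=
  match n with
  | 0 => zlin (V 0) (bobj W 0)
  | n'.+1 => mklin (@trDB_linear n')
  end.

(** A type II map factors through rho, so its image dies in D V; this matches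
    the zero action of type II maps on B W. *)
Lemma trDB_nat m n (f : mor m n) (v : V m) :
  trDB_fun n (cact V f v) = cact (Bfun k s W) f (trDB_fun m v).
Proof.
case: n f => [|n] f; first exact: zmd_eq.
case: (boolP (typeI s f)) => fI; last first.
  by rewrite /= bact_II // -(act_del fI) dpi0 linear0.
case: m f v fI => [|m] f v fI //.
by rewrite /= bact_I // -cnat act_dpi iota_res.
Qed.

Definition trDB : chom V (Bfun k s W) := @CHom k V (Bfun k s W) _ trDB_nat.
End To.

Section From.
Variable g : chom V (Bfun k s W).

Lemma invDB_kills n (v : V n.+1) : immod (cact V (rho s n)) v -> g n.+1 v = 0.
Proof. by move=> [x ->]; rewrite cnat /= bact_II // rho_II. Qed.

Definition invDB_fun n : {linear Dfun k s V n -> W n} := qlift (@invDB_kills n).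

Lemma invDB_nat m n (f : mor m n) (v : Dfun k s V m) :
  invDB_fun n (cact (Dfun k s V) f v) = cact W f (invDB_fun m v).
Proof.
have [x ->] := qpi_surj v; rewrite [cact _ f _]act_dpi !qliftE cnat.
exact: bact_iota.
Qed.

Definition invDB : chom (Dfun k s V) W := @CHom k (Dfun k s V) W _ invDB_nat.
End From.

Lemma trDB_can h : invDB (trDB h) = h.
Proof. by apply: chom_ext => n v; have [x ->] := qpi_surj v; apply: qliftE. Qed.

Lemma invDB_can g : trDB (invDB g) = g.
Proof.
by apply: chom_ext => -[|n] v; [exact: zmd_eq | exact: qliftE].
Qed.
End DB.

Lemma adjoint_D_B : left_adjoint (Dfun k s) (Bfun k s).
Proof.
apply: (left_adjoint_intro trDB_can invDB_can) => V V' W W' f g h [|n] v;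
  first exact: zmd_eq.
by congr (g _ (h _ _)); apply: qmapE.
Qed.

(** * B is left adjoint to SK *)

Section BSK.
Variables V W : cmod k.
Local Notation SK := (compF (Sfun k s) (Kfun k s)).

Section To.
Variable h : chom (Bfun k s V) W.

(** In B V the type II map rho acts by zero. *)
Lemma trBK_ker n (v : V n) : h n.+1 v \in kerp (cact W (rho s n.+1)).
Proof.
apply/eqP; rewrite -cnat (_ : cact (Bfun k s V) (rho s n.+1) v = 0) ?linear0 //.
exact/bact_II/rho_II.
Qed.

Lemma trBK_linear n : linear (fun v : V n => KerMod (trBK_ker v)).
Proof. by move=> a x y; apply: val_inj; rewrite [RHS]linearP /= linearP. Qed.

Lemma trBK_nat m n (f : mor m n) (v : V m) :
  mklin (@trBK_linear n) (cact V f v) = cact (SK W) f (mklin (@trBK_linear m) v).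
Proof.
apply: val_inj; rewrite -[LHS]/(h n.+1 (cact V f v)).
rewrite -[RHS]/(cact W (iota_mor s f) (h m.+1 v)) -cnat; congr (h _ _).
exact/esym/bact_iota.
Qed.

Definition trBK : chom V (SK W) := @CHom k V (SK W) _ trBK_nat.
End To.

Section From.
Variable g : chom V (SK W).

Lemma invBK_linear n : linear (fun v : V n => kerval (g n v) : W n.+1).
Proof. by move=> a x y; rewrite linearP; apply: kerval_linear. Qed.

Definition invBK_fun n : {linear bobj V n -> W n} :=
  match n with
  | 0 => zlin (bobj V 0) (W 0)
  | n'.+1 => mklin (@invBK_linear n')
  end.

Lemma invBK_nat m n (f : mor m n) (v : Bfun k s V m) :
  invBK_fun n (cact (Bfun k s V) f v) = cact W f (invBK_fun m v).
Proof.
case: m f v => [|m] f v; first by rewrite (zmd_eq v 0) !linear0.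
case: n f => [|n] f; first by have := mor_leq f.
case: (boolP (typeI s f)) => fI.
  by rewrite [X in invBK_fun _ X](bact_I _ fI) /= cnat /= iota_res.
rewrite [X in invBK_fun _ X](bact_II _ fI) linear0.
by rewrite /= (typeII_kill fI (kerval0 _)).
Qed.

Definition invBK : chom (Bfun k s V) W := @CHom k (Bfun k s V) W _ invBK_nat.
End From.

Lemma trBK_can h : invBK (trBK h) = h.
Proof.
apply: chom_ext => -[|n] v //; by rewrite (zmd_eq v 0) !linear0.
Qed.

Lemma invBK_can g : trBK (invBK g) = g.
Proof. by apply: chom_ext => n v; apply: val_inj. Qed.
End BSK.

Lemma adjoint_B_SK : left_adjoint (Bfun k s) (compF (Sfun k s) (Kfun k s)).
Proof.
apply: (left_adjoint_intro trBK_can invBK_can) => V V' W W' f g h n v; exact: val_inj.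
Qed.

(** * KQ is isomorphic to B *)

Section KQ.
Variable V : cmod k.
Local Notation KQ := (compF (Kfun k s) (Qfun k s)).

(** Along rho the second coordinate of Q reproduces the first one. *)
Lemma KQ_fst n (x : KQ V n) : (kerval x).1 = 0.
Proof.
have := kerval0 x => /(congr1 snd).
rewrite -[LHS]/(qsnd s (rho s n) (kerval x)) (qsnd_II _ (rho_II n)).
by rewrite act_endo.
Qed.

Lemma KQ_to_B_linear n : linear (fun x : KQ V n => (kerval x).2).
Proof. by move=> a x y; rewrite kerval_linear. Qed.

Lemma KQ_to_B_nat m n (f : mor m n) (x : KQ V m) :
  mklin (@KQ_to_B_linear n) (cact (KQ V) f x) =
  cact (Bfun k s V) f (mklin (@KQ_to_B_linear m) x).
Proof.
rewrite -[LHS]/(qsnd s f (kerval x)).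
case: (boolP (typeI s f)) => fI; first by rewrite qsnd_I.
case: n f fI => [|n] f fI; first exact: zmd_eq.
by rewrite (qsnd_II _ fI) KQ_fst linear0 /= bact_II.
Qed.

Definition KQ_to_B : chom (KQ V) (Bfun k s V) :=
  @CHom k (KQ V) (Bfun k s V) _ KQ_to_B_nat.

Lemma B_to_KQ_ker n (w : bobj V n) :
  ((0, w) : Qfun k s V n) \in kerp (cact (Qfun k s V) (rho s n)).
Proof.
apply/eqP; congr (_, _); first exact: linear0.
rewrite -[LHS]/(qsnd s (rho s n) (0, w)) (qsnd_II _ (rho_II n)).
exact: linear0.
Qed.

Definition B_to_KQ_fun n (w : Bfun k s V n) : KQ V n := KerMod (B_to_KQ_ker w).

Lemma B_to_KQ_linear n : linear (@B_to_KQ_fun n).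
Proof.
move=> a x y; apply: val_inj; rewrite [RHS]linearP.
by congr (_, _); rewrite -[RHS]/(a *: 0 + 0) scaler0 addr0.
Qed.

Lemma KQ_to_B_funK n x : B_to_KQ_fun (KQ_to_B n x) = x.
Proof.
by apply: val_inj; rewrite [RHS]surjective_pairing (KQ_fst x).
Qed.

Lemma B_to_KQ_nat m n (f : mor m n) (w : Bfun k s V m) :
  mklin (@B_to_KQ_linear n) (cact (Bfun k s V) f w) =
  cact (KQ V) f (mklin (@B_to_KQ_linear m) w).
Proof. by rewrite -[RHS]KQ_to_B_funK cnat. Qed.

Definition B_to_KQ : chom (Bfun k s V) (KQ V) :=
  @CHom k (Bfun k s V) (KQ V) _ B_to_KQ_nat.
End KQ.

Lemma nat_iso_KQ : nat_iso (compF (Kfun k s) (Qfun k s)) (Bfun k s).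
Proof.
exists KQ_to_B, B_to_KQ; split; [|split].
- by move=> V W f; apply: chom_ext.
- by move=> V; apply: chom_ext => n x; apply: KQ_to_B_funK.
- by move=> V; apply: chom_ext.
Qed.

End ShiftAdjunctions.

(** * Gamma is left adjoint to S *)

Section Segments.
Variable s : side.

Lemma iota_inj m n : injective (@iota_mor s m n).
Proof. by move=> f g /(congr1 (@res_mor s m n)); rewrite !res_iota. Qed.

Lemma compm_inj m n p (g : mor n p) : injective (@compm m n p g).
Proof.
move=> f f' E; apply: mor_ext => i; apply: (@mor_inj _ _ g).
by rewrite -!compmE E.
Qed.

Lemma seg_lt n (i : 'I_n) (j : 'I_(gdeg s i).+1) :
  ((if s is sa then i + j else j) < n)%N.
Proof.
case: i j => i lti; rewrite /gdeg; case: (s) => -[j] /= ltj.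
  by rewrite -ltn_subRL -subnSK.
exact: leq_trans ltj lti.
Qed.

Lemma seg_mono (i a b : nat) :
  (a < b)%N -> ((if s is sa then i + a else a) < if s is sa then i + b else b)%N.
Proof. by case: s; rewrite // ltn_add2l. Qed.

(** The segment of [n] that carries the summand of index i of Gamma: the point
    i, sent there from the pole, together with the points behind it (side a)
    or before it (side b). The morphism gmor f i is the restriction of f to
    these segments, see seg_gmor. *)
Definition seg n (i : 'I_n) : mor (gdeg s i).+1 n :=
  @mkmor _ _ (fun j => Ordinal (seg_lt j)) (fun j j' h => seg_mono i h).

Lemma seg_val n (i : 'I_n) j : seg i j = (if s is sa then i + j else j)%N :> nat.
Proof. by rewrite mkmorE. Qed.

Lemma val_pole n : pole s n = (if s is sa then 0 else n)%N :> nat.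
Proof. by case: s. Qed.

Lemma seg_pole n (i : 'I_n) : seg i (pole s (gdeg s i)) = i.
Proof. by apply: val_inj; rewrite /= seg_val val_pole; case: s; rewrite ?addn0. Qed.

Lemma seg_lift n (i : 'I_n) (j : 'I_(gdeg s i)) :
  seg i (lift (pole s (gdeg s i)) j) = (if s is sa then i.+1 + j else j)%N :> nat.
Proof.
by rewrite seg_val val_lift_pole; move: (nat_of_ord j) => a; case: s; rewrite ?addnS.
Qed.

Lemma seg_gmor m n (f : mor m n) (i : 'I_m) :
  compm f (seg i) = compm (seg (f i)) (iota_mor s (gmor s f i)).
Proof.
apply: (@mor_extS s) => [|j]; rewrite !compmE ?iota_pole ?iota_lift ?seg_pole //.
apply: val_inj; rewrite /= seg_lift.
have := seg_lift j; move: (seg i _) => x.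
rewrite /gmor; move: j; rewrite /gdeg; case: (s) => j E.
  rewrite gmor_aE subnKC; last exact: tail_gt.
  by congr (nat_of_ord (f _)); apply: val_inj.
by rewrite gmor_bE; congr (nat_of_ord (f _)); apply: val_inj.
Qed.

Lemma gdeg_pole n : gdeg s (pole s n) = n.
Proof. by rewrite /gdeg; case: (s) => //=; rewrite subSS subn0. Qed.

End Segments.

Section GS.
Variables (k : pzRingType) (s : side).
Implicit Types U V W : cmod k.

Section Adj.
Variables V W : cmod k.

(** The injection of the summand of index i, from a module V d whose degree is
    only propositionally that of the summand. *)
Definition gin n (i : 'I_n) d (e : (d <= gdeg s i)%N) (v : V d) : Gamma k s V n :=
  ginj (cact V (incl e) v).

Lemma gin_linear n (i : 'I_n) d (e : (d <= gdeg s i)%N) : linear (gin e).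
Proof. by move=> a x y; rewrite /gin /ginj !linearP. Qed.

Lemma gin_act m n (f : mor m n) (i : 'I_m) (j : 'I_n) d d'
    (e : (d <= gdeg s i)%N) (e' : (d' <= gdeg s j)%N) (g : mor d d') (v : V d) :
  j = f i ->
  compm (compm f (seg s i)) (iota_mor s (incl e)) =
    compm (compm (seg s j) (iota_mor s (incl e'))) (iota_mor s g) ->
  cact (Gamma k s V) f (gin e v) = gin e' (cact V g v).
Proof.
move=> E; move: e'; rewrite E => e'.
rewrite seg_gmor -!compmA -!iota_comp => /compm_inj /iota_inj F.
by rewrite [LHS]gact_inj /gin -!cact_comp F.
Qed.

Lemma le_gdeg_pole n : (n <= gdeg s (pole s n))%N.
Proof. by rewrite gdeg_pole. Qed.

(** The unit V -> S Gamma V: the summand of Gamma(V)_{n+1} at the pole is V_n. *)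
Definition gtop n (v : V n) : Gamma k s V n.+1 := gin (le_gdeg_pole n) v.

Lemma gtop_linear n : linear (@gtop n).
Proof. exact: gin_linear. Qed.

Lemma seg_pole_endo n :
  compm (seg s (pole s n)) (iota_mor s (incl (le_gdeg_pole n))) = idm n.+1.
Proof. exact: mor_endo. Qed.

Lemma gtop_act m n (f : mor m n) (v : V m) :
  cact (Gamma k s V) (iota_mor s f) (gtop v) = gtop (cact V f v).
Proof.
apply: gin_act; first by rewrite iota_pole.
by rewrite seg_pole_endo comp1m -compmA seg_pole_endo compm1.
Qed.

(** The summand of index i is the image under seg i of the summand at the
    pole, so Gamma V is generated by the image of the unit; this determines a
    map out of Gamma V and gives the formula for invGS_fun. *)
Lemma seg_gtop n (i : 'I_n) (v : V (gdeg s i)) :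
  cact (Gamma k s V) (seg s i) (gtop v) = ginj v.
Proof.
rewrite -[RHS](_ : gin (leqnn _) v = _); last by rewrite /gin act_endo.
rewrite -[v in RHS](act_endo (idm _)); apply: gin_act; first by rewrite seg_pole.
by rewrite -compmA seg_pole_endo incl_id !iota_id !compm1.
Qed.

Section To.
Variable h : chom (Gamma k s V) W.

Lemma trGS_linear n : linear (fun v : V n => h n.+1 (gtop v)).
Proof. by move=> a x y; rewrite gtop_linear linearP. Qed.

Lemma trGS_nat m n (f : mor m n) (v : V m) :
  mklin (@trGS_linear n) (cact V f v) = cact (Sfun k s W) f (mklin (@trGS_linear m) v).
Proof. by rewrite /= -gtop_act cnat. Qed.

Definition trGS : chom V (Sfun k s W) := @CHom k V (Sfun k s W) _ trGS_nat.
End To.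

Section From.
Variable g : chom V (Sfun k s W).

Definition invGS_fun n (x : Gamma k s V n) : W n :=
  \sum_(i < n) cact W (seg s i) (g _ (x i)).

Lemma invGS_linear n : linear (@invGS_fun n).
Proof.
move=> a x y; rewrite /invGS_fun scaler_sumr -big_split /=; apply: eq_bigr => i _.
by rewrite dsD dsZ !linearP.
Qed.

Lemma invGS_ginj n (i : 'I_n) (v : V (gdeg s i)) :
  invGS_fun (ginj v) = cact W (seg s i) (g _ v).
Proof.
rewrite /invGS_fun (bigD1 i) //= dinj_in big1 ?addr0 // => j ji.
by rewrite dinj_out 1?eq_sym // !linear0.
Qed.

Lemma invGS_nat m n (f : mor m n) (x : Gamma k s V m) :
  mklin (@invGS_linear n) (cact (Gamma k s V) f x) = cact W f (mklin (@invGS_linear m) x).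
Proof.
apply: (@gobj_lin_ext k s V m _ (mklin (@invGS_linear n) \o gact s V f)
  (cact W f \o mklin (@invGS_linear m))) => i v.
rewrite -[LHS]/(invGS_fun (gact s V f (ginj v))) -[RHS]/(cact W f (invGS_fun (ginj v))).
by rewrite gact_inj !invGS_ginj cnat -!cact_comp seg_gmor.
Qed.

Definition invGS : chom (Gamma k s V) W := @CHom k (Gamma k s V) W _ invGS_nat.
End From.

Lemma trGS_can h : invGS (trGS h) = h.
Proof.
apply: chom_ext => n; apply: gobj_lin_ext => i v.
by rewrite -[LHS]/(invGS_fun _ _) invGS_ginj /= -cnat seg_gtop.
Qed.

Lemma invGS_can g : trGS (invGS g) = g.
Proof.
apply: chom_ext => n v.
by rewrite -[LHS]/(invGS_fun _ _) invGS_ginj cnat -cact_comp act_endo.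
Qed.
End Adj.

Lemma adjoint_Gamma_S : left_adjoint (Gamma k s) (Sfun k s).
Proof.
apply: (left_adjoint_intro trGS_can invGS_can) => V V' W W' f g h n v.
congr (g _ (h _ _)); rewrite [LHS]gmap_inj; congr (ginj _).
exact: cnat.
Qed.

(** The composite D Gamma is left adjoint to S B, hence to the identity
    functor, since S B is isomorphic to it. A left adjoint of the identity is
    the identity. *)
Lemma nat_iso_DG :
  nat_iso (compF (Dfun k s) (Gamma k s)) (compF (Sfun k s) (Bfun k s)).
Proof.
apply: nat_iso_trans (nat_iso_sym (nat_iso_SB k s)).
apply: left_adjoint_unique (left_adjoint_id k).
apply: left_adjoint_iso (nat_iso_SB k s).
exact: left_adjoint_comp (adjoint_D_B k s) adjoint_Gamma_S.
Qed.
End GS.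

(** * Maps out of Psi *)

Section LimLift.
Variables (k : pzRingType) (V : cmod k) (X : lmodType k).
Variable f : forall n, {linear V n -> X}.
Hypothesis f_incl : forall m n (h : (m <= n)%N) (v : V m),
  f n (cact V (incl h) v) = f m v.

Definition lim_lift_fun (x : lim V) : X := f (lim_deg x) (lim_rep x).

Lemma lim_lift_funE n (v : V n) : lim_lift_fun (lin v) = f n v.
Proof.
have /lin_eq [N [h [h' E]]] := lim_repK (lin v).
by rewrite /lim_lift_fun -(f_incl h) E f_incl.
Qed.

Lemma lim_lift_linear : linear lim_lift_fun.
Proof.
move=> a x y; have [n [u [v [-> ->]]]] := lim_surj2 x y.
by rewrite -linearP !lim_lift_funE linearP.
Qed.

Definition lim_lift : {linear lim V -> X} := mklin lim_lift_linear.

Lemma lim_liftE n (v : V n) : lim_lift (lin v) = f n v.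
Proof. exact: lim_lift_funE. Qed.
End LimLift.

Section Coinv.
Variables (k : pzRingType) (V : cmod k).

Lemma coinv_eq m n (f g : mor m n) (v : V m) :
  qpi (aug V n) (cact V f v) = qpi (aug V n) (cact V g v).
Proof. by apply/qpiP/span_gen; exists m, f, g, v. Qed.

(** A map that does not distinguish parallel morphisms factors through the
    coinvariants. *)
Lemma aug_kills n (X : lmodType k) (f : {linear V n -> X}) :
  (forall m (a b : mor m n) v, f (cact V a v) = f (cact V b v)) ->
  forall v, aug V n v -> f v = 0.
Proof.
move=> fE v; elim=> [|a u w [m [p [q [x ->]]]] _ IH]; first exact: linear0.
by rewrite linearP IH addr0 linearB (fE m p q) subrr scaler0.
Qed.
End Coinv.

Section Psi.
Variables (k : pzRingType) (s : side).
Implicit Types U V W : cmod k.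
Local Notation t := (opp_side s).
Local Notation DS n V := (Dfun k t (Spow k t n V)).

(** The class in Psi(V)_n of an element of V_{n+r+1}: it represents an element
    of D S^n V in degree r, hence one of the coinvariants, hence one of the
    direct limit. Everything about Psi is expressed through these classes,
    which exhaust it and have cls_rho and cls_incr as their only relations
    besides linearity. *)
Definition cls V n r (v : V (n + r.+1)%N) : Psi k s V n :=
  @lin k (AD k s (Spow k t n V)) r
    (qpi (aug (DS n V) r) (@dpi k t (Spow k t n V) r v)).

Lemma cls_linear V n r : linear (@cls V n r).
Proof. by move=> a x y; rewrite /cls dpi_linear !linearP. Qed.

Lemma cls_rho V n r (v : V (n + r)%N) :
  cls (cact V (iota_pow t n (rho t r)) v) = 0.
Proof.
by rewrite /cls (@dpi0 k t (Spow k t n V) r v) !linear0.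
Qed.

(** In the coinvariants g acts as the inclusion, which the direct limit
    identifies with the identity. *)
Lemma cls_incr V n r r' (g : mor r r') (v : V (n + r.+1)%N) :
  cls (cact V (iota_pow t n (iota_mor t g)) v) = cls v.
Proof.
rewrite /cls -[dpi _ _](@act_dpi k t (Spow k t n V) _ _ g v).
rewrite (coinv_eq g (incl (mor_leq g))).
rewrite -[RHS](lin_incl (mor_leq g)); congr (lin _).
exact/esym/qmapE.
Qed.

Lemma cls_act V m n (f : mor m n) r (v : V (m + r.+1)%N) :
  cact (Psi k s V) f (cls v) = cls (cact V (glue s f r.+1) v).
Proof.
rewrite [LHS]lim_mapE; congr (lin _).
by rewrite [LHS]qmapE; congr (qpi _ _); apply: qmapE.
Qed.

Lemma cls_map V W (h : chom V W) n r (v : V (n + r.+1)%N) :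
  fmap (Psi k s) h n (cls v) = cls (h _ v).
Proof.
rewrite [LHS]lim_mapE; congr (lin _).
by rewrite [LHS]qmapE; congr (qpi _ _); apply: qmapE.
Qed.

Lemma cls_surj V n (x : Psi k s V n) : exists r (v : V (n + r.+1)%N), x = cls v.
Proof.
have [r [y ->]] := lim_surj x; have [z ->] := qpi_surj y.
by have [v ->] := qpi_surj z; exists r, v.
Qed.

Section Lift.
Variables (V : cmod k) (n : nat) (X : lmodType k).
Variable f : forall r, {linear V (n + r.+1)%N -> X}.
Hypothesis f_rho : forall r (v : V (n + r)%N),
  f r (cact V (iota_pow t n (rho t r)) v) = 0.
Hypothesis f_incr : forall r r' (g : mor r r') (v : V (n + r.+1)%N),
  f r' (cact V (iota_pow t n (iota_mor t g)) v) = f r v.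

Lemma f_immod r (v : Spow k t n V r.+1) :
  immod (cact (Spow k t n V) (rho t r)) v -> f r v = 0.
Proof. by move=> [u ->]; apply: f_rho. Qed.

Definition f_D r : {linear DS n V r -> X} := qlift (@f_immod r).

Lemma f_D_act r r' (g : mor r r') x : f_D r' (cact (DS n V) g x) = f_D r x.
Proof.
have [v ->] := qpi_surj x; rewrite [cact _ _ _]act_dpi !qliftE.
exact: f_incr.
Qed.

Lemma f_D_aug r x : aug (DS n V) r x -> f_D r x = 0.
Proof. by apply: aug_kills => m a b v; rewrite !f_D_act. Qed.

Definition f_AD r : {linear AD k s (Spow k t n V) r -> X} := qlift (@f_D_aug r).

Lemma f_AD_incl m p (h : (m <= p)%N) x :
  f_AD p (cact (AD k s (Spow k t n V)) (incl h) x) = f_AD m x.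
Proof.
have [v ->] := qpi_surj x; rewrite [cact _ _ _]qmapE !qliftE.
exact: f_D_act.
Qed.

(** The universal property of Psi(V)_n: a family of maps on the V_{n+r+1} that
    respects the two relations of cls extends to it. *)
Definition psi_lift : {linear Psi k s V n -> X} := lim_lift f_AD_incl.

Lemma psi_liftE r (v : V (n + r.+1)%N) : psi_lift (cls v) = f r v.
Proof. by rewrite /cls [LHS]lim_liftE !qliftE. Qed.
End Lift.
End Psi.

(** * Factorisations through the removed point *)

Section Middle.
Variable s : side.
Local Notation t := (opp_side s).

Lemma gdeg_sum n (i : 'I_n) : (gdeg s i + (gdeg t i).+1)%N = n.
Proof.
rewrite /gdeg; case: s => /=; last by rewrite addnS -addSn subnKC.
by rewrite subnK.
Qed.

Lemma mid_lt n r : ((if s is sa then r else n) < n + r.+1)%N.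
Proof. by case: s; rewrite addnS ltnS ?leq_addr ?leq_addl. Qed.

(** The point of [n + r + 1] that separates the n points on which a morphism
    acts in Psi from the r points that the direct limit stabilises; it lies
    after the r points for a and after the n points for b. The increasing map
    that skips it is the one whose cokernel D takes, and the summand of Gamma
    of this index has degree n. *)
Definition mid n r : 'I_(n + r.+1) := Ordinal (mid_lt n r).

Lemma val_mid n r : mid n r = (if s is sa then r else n) :> nat.
Proof. by []. Qed.

Lemma gdeg_mid n r : gdeg s (mid n r) = n.
Proof. by rewrite /gdeg val_mid; case: s; rewrite // addnK. Qed.

Lemma gdeg_opp_mid n r : gdeg t (mid n r) = r.
Proof. by rewrite /gdeg val_mid; case: s => //=; rewrite -addSnnS addKn. Qed.

Lemma iota_pow_mid n r r' (g : mor r r') :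
  iota_pow t n (iota_mor t g) (mid n r) = mid n r'.
Proof.
apply: ord_inj; rewrite val_mid; move: (mid n r) (val_mid n r) => x.
case: s => /= E.
  rewrite (iota_pow_b_lo _ (i' := ord_max)) //.
  by rewrite -[ord_max]/(pole sb r) iota_pole.
rewrite (iota_pow_a_hi _ (i' := ord0)) ?addn0 //.
by rewrite -[ord0]/(pole sa r) iota_pole addn0.
Qed.

Lemma iota_pow_rho n r (y : 'I_(n + r)) :
  iota_pow t n (rho t r) y = bump (mid n r) y :> nat.
Proof.
rewrite /bump val_mid; case: s => /=.
  have [ltr|ler] := ltnP y r.
    by rewrite (iota_pow_b_lo _ (i' := Ordinal ltr)) // rho_lift val_lift_pole.
  rewrite (iota_pow_b_hi _ (d := y - r)) ?subnKC //.
  by rewrite addSn subnKC.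
have [ltn|len] := ltnP y n; first by rewrite iota_pow_a_lo.
have lty : (y - n < r)%N by rewrite ltn_subLR.
rewrite (iota_pow_a_hi _ (i' := Ordinal lty)) ?subnKC //.
by rewrite rho_lift val_lift_pole addnS subnKC.
Qed.

Lemma mid_rho n r (y : 'I_(n + r)) : iota_pow t n (rho t r) y != mid n r.
Proof. by rewrite -(inj_eq (@ord_inj _)) iota_pow_rho eq_sym neq_bump. Qed.

Lemma unbump_lt a b n : b != a -> (a < n.+1 -> b < n.+1 -> unbump a b < n)%N.
Proof.
rewrite neq_ltn /unbump !ltnS => /orP[lt_ba|lt_ab] le_a le_b.
  by rewrite (ltnNge a) (ltnW lt_ba) subn0 (leq_trans lt_ba).
by rewrite lt_ab subn1; case: b lt_ab le_b.
Qed.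

(** A morphism which misses mid has its image in that of iota^n rho, so it
    dies in Psi. *)
Lemma rho_factor m n r (f : mor m (n + r.+1)) :
  (forall i, f i != mid n r) ->
  exists g : mor m (n + r), f = compm (iota_pow t n (rho t r)) g.
Proof.
move=> fN; apply: mor_factor => i.
have E : bump (mid n r) (unbump (mid n r) (f i)) = f i.
  by apply: unbumpK; rewrite inE (inj_eq val_inj).
have lty : (unbump (mid n r) (f i) < n + r)%N.
  apply: unbump_lt; first by rewrite (inj_eq val_inj).
    by rewrite -addnS; apply: ltn_ord.
  by rewrite -addnS.
by exists (Ordinal lty); apply: ord_inj; rewrite iota_pow_rho.
Qed.

(** A morphism f preserves the decomposition of [m] by a point i: it acts on
    one side of i by the gmor of s, which is the action on Psi, and on the
    other side by the gmor of the opposite side, which the coinvariants and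
    the limit ignore. *)
Lemma glue_factor m n (f : mor m n) (i : 'I_m)
    (e : (m <= gdeg s i + (gdeg t i).+1)%N)
    (e' : (n <= gdeg s (f i) + (gdeg t (f i)).+1)%N) :
  compm (incl e') f =
  compm (iota_pow t _ (iota_mor t (gmor t f i)))
    (compm (glue s (gmor s f i) (gdeg t i).+1) (incl e)).
Proof.
apply: mor_ext => x; apply: ord_inj; rewrite !compmE inclE.
have ex := inclE e x; move: (incl e x) ex => y Ey.
case: s e e' y Ey => e e' y Ey; rewrite [opp_side _]/=.
  (* Side a: x lies among the first r points, among the last n, or is i. *)
  rewrite /glue mkmorE; case: (ltngtP x i) => [ltx|gtx|eqx].
  - have lty : (y < (gdeg sb i).+1)%N by rewrite Ey ltnS ltnW.
    rewrite (iota_pow_b_lo _ (i' := lift (pole sb _) (Ordinal (ltx : x < gdeg sb i)%N))).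
      rewrite iota_lift val_lift_pole gmor_bE.
      by congr (nat_of_ord (f _)); apply: ord_inj.
    by rewrite glue_a_lo // val_lift_pole Ey.
  - have ltd : (x - i.+1 < gdeg sa i)%N by rewrite ltn_sub2r // (leq_trans _ (ltn_ord x)).
    rewrite (iota_pow_b_hi _ (d := gmor sa f i (Ordinal ltd))).
      rewrite gmor_aE addSn -addSn subnKC; last exact: tail_gt.
      by congr (nat_of_ord (f _)); apply: ord_inj; rewrite /= subnKC.
    by rewrite (glue_a_hi _ (i' := Ordinal ltd)) // Ey /= subnKC.
  - rewrite (iota_pow_b_lo _ (i' := pole sb _)) ?iota_pole.
      by congr (nat_of_ord (f _)); apply: ord_inj.
    by rewrite glue_a_lo Ey eqx /=.
(* Side b: x lies among the first n points, among the last r, or is i. *)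
rewrite /glue mkmorE; case: (ltngtP x i) => [ltx|gtx|eqx].
- have E := glue_b_lo (gmor sb f i) (r := (gdeg sa i).+1)
    (i' := Ordinal (ltx : x < gdeg sb i)%N) Ey.
  rewrite iota_pow_a_lo E gmor_bE; first by congr (nat_of_ord (f _)); apply: ord_inj.
  exact: mor_lt.
- have ltd : (x - i.+1 < gdeg sa i)%N by rewrite ltn_sub2r // (leq_trans _ (ltn_ord x)).
  rewrite (iota_pow_a_hi _ (i' := lift (pole sa _) (Ordinal ltd))).
    rewrite iota_lift val_lift_pole gmor_aE addnS -addSn subnKC; last exact: tail_gt.
    by congr (nat_of_ord (f _)); apply: ord_inj; rewrite /= subnKC.
  by apply: glue_b_hi; rewrite val_lift_pole Ey /= addnS -addSn subnKC.
- rewrite (iota_pow_a_hi _ (i' := pole sa _)) ?iota_pole.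
    by rewrite addn0; congr (nat_of_ord (f _)); apply: ord_inj.
  by apply: glue_b_hi; rewrite Ey eqx addn0.
Qed.
End Middle.

(** * Psi is left adjoint to Gamma *)

Section PG.
Variables (k : pzRingType) (s : side).
Implicit Types U V W : cmod k.
Local Notation t := (opp_side s).

Lemma gact_im V m n (f : mor m n) (x : Gamma k s V m) i :
  (cact (Gamma k s V) f x : gobj s V n) (f i) = cact V (gmor s f i) ((x : gobj s V m) i).
Proof.
rewrite /= /gact_fun ds_sum (bigD1 i) //= dinj_in big1 ?addr0 // => j ji.
by rewrite dinj_out // (inj_eq (@mor_inj _ _ f)).
Qed.

Lemma gact_out V m n (f : mor m n) (x : Gamma k s V m) j :
  (forall i, f i != j) -> (cact (Gamma k s V) f x : gobj s V n) j = 0.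
Proof.
by move=> fN; rewrite /= /gact_fun ds_sum big1 // => i _; rewrite dinj_out.
Qed.

(** The component of index i, read in a module V d whose degree is only
    propositionally that of the summand. *)
Definition gcomp V n (i : 'I_n) d (e : (gdeg s i <= d)%N) (x : Gamma k s V n) : V d :=
  cact V (incl e) ((x : gobj s V n) i).

Lemma gcomp_linear V n (i : 'I_n) d (e : (gdeg s i <= d)%N) : linear (@gcomp V n i d e).
Proof. by move=> a x y; rewrite /gcomp dsD dsZ linearP. Qed.

Lemma gcomp_act V m n (f : mor m n) (i : 'I_m) (j : 'I_n) d d'
    (e : (gdeg s i <= d)%N) (e' : (gdeg s j <= d')%N) (g : mor d d') (x : Gamma k s V m) :
  f i = j -> (forall y, gmor s f i y = g (incl e y) :> nat) ->
  gcomp e' (cact (Gamma k s V) f x) = cact V g (gcomp e x).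
Proof.
move=> E; move: e'; rewrite -E => e' H.
rewrite /gcomp gact_im -!cact_comp; congr (cact V _ _).
by apply: mor_ext => y; apply: ord_inj; rewrite !compmE inclE.
Qed.

Lemma gcomp_endo V m n (f : mor m n) (i : 'I_m) (j : 'I_n) d
    (e : (gdeg s i <= d)%N) (e' : (gdeg s j <= d)%N) (x : Gamma k s V m) :
  f i = j -> gdeg s i = gdeg s j ->
  gcomp e' (cact (Gamma k s V) f x) = gcomp e x.
Proof.
move=> E E'; rewrite -[RHS]cact_id; apply: gcomp_act => // y.
by rewrite idmE inclE mor_val // E E'.
Qed.

Lemma le_gdeg_sum n (i : 'I_n) : (n <= gdeg s i + (gdeg t i).+1)%N.
Proof. by rewrite gdeg_sum. Qed.

Lemma gdeg_mid_le n r : (gdeg s (mid s n r) <= n)%N.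
Proof. by rewrite gdeg_mid. Qed.

Lemma glue_mid m n (f : mor m n) r : glue s f r.+1 (mid s m r) = mid s n r.
Proof.
apply: ord_inj; rewrite val_mid; have := val_mid s m r; move: (mid s m r) => x.
rewrite /glue; case: s => E; rewrite mkmorE; first by rewrite glue_a_lo // E.
by rewrite (glue_b_hi _ (d := 0)) addn0.
Qed.

Lemma gmor_glue m n (f : mor m n) r (e : (gdeg s (mid s m r) <= m)%N) y :
  gmor s (glue s f r.+1) (mid s m r) y = f (incl e y) :> nat.
Proof.
have := glue_mid f r; move: y (incl e y) (inclE e y) => y z Ez.
rewrite /glue; case: s e y Ez => e y Ez /(congr1 (@nat_of_ord _)) glue_m.
  rewrite gmor_aE glue_m mkmorE (glue_a_hi _ (i' := z)) ?addKn //.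
  by rewrite /= Ez.
by rewrite gmor_bE mkmorE; apply: glue_b_lo.
Qed.

Section Adj.
Variables V W : cmod k.

Section To.
Variable h : chom (Psi k s V) W.

(** An index i splits [n] into two intervals of lengths gdeg s i and gdeg t i,
    so v in V_n has a class in Psi(V) in degree gdeg s i, the degree of the
    summand of index i of Gamma(W)_n. Applying h to all these classes gives
    the transpose. *)
Definition trPG_fun n (v : V n) : gobj s W n :=
  [ffun i : 'I_n => h _ (cls s (cact V (incl (le_gdeg_sum i)) v))].

Lemma trPG_linear n : linear (@trPG_fun n).
Proof.
by move=> a x y; apply/ffunP => i; rewrite dsD dsZ !ffunE linearP cls_linear linearP.
Qed.

(** At an index f i both sides agree by glue_factor. At an index j outside the
    image of f, the right-hand side vanishes by the definition of Gamma, and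
    the left-hand side because f misses the middle point. *)
Lemma trPG_nat m n (f : mor m n) (v : V m) :
  mklin (@trPG_linear n) (cact V f v) = cact (Gamma k s W) f (mklin (@trPG_linear m) v).
Proof.
apply/ffunP => j; rewrite [LHS]ffunE.
have [[i <-]|fN] := pselect (exists i, f i = j).
  rewrite [RHS]gact_im ffunE -cnat cls_act -!cact_comp.
  by rewrite (glue_factor (le_gdeg_sum i)) cact_comp cls_incr.
have {}fN i : f i != j by apply/eqP => E; apply: fN; exists i.
rewrite [RHS]gact_out // -cact_comp.
have [i|g ->] := @rho_factor s _ _ _ (compm (incl (le_gdeg_sum j)) f).
  rewrite compmE; apply: contraNneq (fN i) => E.
  apply/eqP/ord_inj; move: (congr1 (@nat_of_ord _) E).
  by rewrite inclE val_mid /gdeg; case: (s).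
by rewrite cact_comp cls_rho linear0.
Qed.

Definition trPG : chom V (Gamma k s W) := @CHom k V (Gamma k s W) _ trPG_nat.
End To.

Section From.
Variable g : chom V (Gamma k s W).

Lemma invPG_comp_linear n r :
  linear (fun v : V (n + r.+1)%N => gcomp (gdeg_mid_le n r) (g _ v)).
Proof. by move=> a x y; rewrite linearP gcomp_linear. Qed.

Lemma invPG_rho n r (v : V (n + r)%N) :
  mklin (@invPG_comp_linear n r) (cact V (iota_pow t n (rho t r)) v) = 0.
Proof.
rewrite -[LHS]/(gcomp _ (g _ _)) cnat /gcomp gact_out ?linear0 // => i.
exact: mid_rho.
Qed.

Lemma invPG_incr n r r' (f : mor r r') (v : V (n + r.+1)%N) :
  mklin (@invPG_comp_linear n r') (cact V (iota_pow t n (iota_mor t f)) v) =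
  mklin (@invPG_comp_linear n r) v.
Proof.
rewrite -[LHS]/(gcomp _ (g _ _)) cnat; apply: gcomp_endo.
  exact: iota_pow_mid.
by rewrite !gdeg_mid.
Qed.

(** On the class of v in V_{n+r+1}, the component of g v at the middle point,
    which has degree n. It is well defined because that point is missed by
    iota^n rho and preserved by the maps iota^n (iota f). *)
Definition invPG_fun n : {linear Psi k s V n -> W n} :=
  psi_lift (@invPG_rho n) (@invPG_incr n).

Lemma invPG_cls n r (v : V (n + r.+1)%N) :
  invPG_fun n (cls s v) = gcomp (gdeg_mid_le n r) (g _ v).
Proof. exact: psi_liftE. Qed.

Lemma invPG_nat m n (f : mor m n) (x : Psi k s V m) :
  invPG_fun n (cact (Psi k s V) f x) = cact W f (invPG_fun m x).
Proof.
have [r [v ->]] := cls_surj x; rewrite cls_act !invPG_cls cnat.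
by apply: gcomp_act; [exact: glue_mid | exact: gmor_glue].
Qed.

Definition invPG : chom (Psi k s V) W := @CHom k (Psi k s V) W invPG_fun invPG_nat.
End From.

Lemma trPG_can h : invPG (trPG h) = h.
Proof.
apply: chom_ext => n x; have [r [v ->]] := cls_surj x.
rewrite [LHS]invPG_cls /gcomp [X in cact W _ X]ffunE -cnat cls_act; congr (h n _).
have le_r : (gdeg t (mid s n r) <= r)%N by rewrite gdeg_opp_mid.
by rewrite -(cls_incr s (incl le_r)) -!cact_comp act_endo.
Qed.

Lemma invPG_can g : trPG (invPG g) = g.
Proof.
apply: chom_ext => n v; apply/ffunP => i; rewrite [LHS]ffunE.
rewrite [LHS]invPG_cls cnat (@gcomp_endo _ _ _ _ i _ _ (leqnn _)) ?gdeg_mid //.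
  by rewrite /gcomp act_endo.
by apply: ord_inj; rewrite inclE val_mid /gdeg; case: (s).
Qed.
End Adj.

Lemma adjoint_Psi_Gamma : left_adjoint (Psi k s) (Gamma k s).
Proof.
apply: (left_adjoint_intro trPG_can invPG_can) => V V' W W' f g h n v.
apply/ffunP => i; rewrite [LHS]ffunE [RHS]ffunE ffunE; congr (g _ (h _ _)).
by rewrite cls_map cnat.
Qed.
End PG.

(** * The quintuple, the triple and the isomorphisms *)

Theorem theorem1p1 (k : comPzRingType) (s : side) :
  (left_adjoint (Psi k s) (Gamma k s) /\
   left_adjoint (Gamma k s) (Sfun k s) /\
   left_adjoint (Sfun k s) (Qfun k s) /\
   left_adjoint (Qfun k s) (Rfun k s)) /\
  (left_adjoint (Dfun k s) (Bfun k s) /\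
   left_adjoint (Bfun k s) (compF (Sfun k s) (Kfun k s))) /\
  (nat_iso (compF (Kfun k s) (Qfun k s)) (Bfun k s) /\
   nat_iso (compF (Dfun k s) (Gamma k s)) (compF (Sfun k s) (Bfun k s)) /\
   nat_iso (compF (Sfun k s) (Bfun k s)) (idF k)).
Proof.
split; [split; [|split; [|split]] | split; [split | split; [|split]]].
- exact: adjoint_Psi_Gamma.
- exact: adjoint_Gamma_S.
- exact: adjoint_S_Q.
- exact: adjoint_Q_R.
- exact: adjoint_D_B.
- exact: adjoint_B_SK.
- exact: nat_iso_KQ.
- exact: nat_iso_DG.
- exact: nat_iso_SB.
Qed.
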